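(* Let $n\in\mathbb{N}$, $\Theta>0$, let $\gamma_1,\dots,\gamma_n>0$ with $\sum_{k=1}^n\gamma_k=1$, and let $\mu=\bigotimes_{k=1}^n\mu_k$ be a product of Borel probability measures $\mu_k$ on $\mathbb{R}$. Let $\varphi,f:\mathbb{R}^n\to\mathbb{R}$ be bounded and continuous, let $\Phi:\mathbb{R}\to\mathbb{R}$ be twice differentiable with $\Phi''(x)<0$ for all $x\in[\inf\varphi,\sup\varphi]$, and for $\nu\in\mathcal{M}^+_1(\mathbb{R}^n)$ set $${\bf \Phi}[\nu]:=\Phi\Big(\int\varphi\,d\nu\Big)+\int f\,d\nu.$$ Then $$\sup_{\nu\in\mathcal{K}}\big\{{\bf \Phi}[\nu]-H(\nu\mid\mu)\big\}=\inf_{(q,{\bf m})\in[\inf\varphi,\sup\varphi]\times\Delta}P(q,{\bf m}),$$ where $$P(q,{\bf m}):=\Phi(q)-q\Phi'(q)+P^{\,q,{\bf m}}_0+\sum_{k=1}^n\frac{\gamma_k\Theta\log 2}{m_k}-\Theta\log 2,$$ and the set $\mathcal{K}$, the set $\Delta$ and the number $P^{\,q,{\bf m}}_0$ are as defined in the context.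
   Context: $\mathcal{M}^+_1(\mathbb{R}^n)$ is the space of Borel probability measures on $\mathbb{R}^n$. For $\nu\in\mathcal{M}^+_1(\mathbb{R}^n)$ and $1\le k\le n$, $\nu^{(k)}$ denotes the marginal of $\nu$ on the first $k$ coordinates (so $\mu^{(k)}=\mu_1\otimes\dots\otimes\mu_k$). Relative entropy: $H(\nu^{(k)}\mid\mu^{(k)})=\int\log\frac{d\nu^{(k)}}{d\mu^{(k)}}\,d\nu^{(k)}$ if $\nu^{(k)}\ll\mu^{(k)}$, and $+\infty$ otherwise. Define $$\mathcal{K}:=\Big\{\nu\in\mathcal{M}^+_1(\mathbb{R}^n):\ H(\nu^{(k)}\mid\mu^{(k)})\le\Theta\log 2\sum_{j=1}^k\gamma_j\quad\forall k\in\{1,\dots,n\}\Big\},$$ $$\Delta:=\{{\bf m}=(m_1,\dots,m_n)\in[0,1]^n:\ 0<m_1\le m_2\le\dots\le m_n\le1\}.$$ For $q\in[\inf\varphi,\sup\varphi]$ and ${\bf m}\in\Delta$, define functions $P^{\,q,{\bf m}}_j:\mathbb{R}^j\to\mathbb{R}$, $j=n,n-1,\dots,0$, recursively by $$P^{\,q,{\bf m}}_n(x_1,\dots,x_n)=\Phi'(q)\varphi(x_1,\dots,x_n)+f(x_1,\dots,x_n),$$ $$P^{\,q,{\bf m}}_{j-1}(x_1,\dots,x_{j-1})=\frac1{m_j}\log\int\exp\big(m_jP^{\,q,{\bf m}}_j(x_1,\dots,x_j)\big)\,\mu_j(dx_j),\qquad 1\le j\le n,$$ so that $P^{\,q,{\bf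 m}}_0$ is a real number. *)

(* Defs.v *)
From HB Require Import structures.
From mathcomp Require Export all_boot all_order all_algebra.
From mathcomp Require Export all_classical all_reals all_analysis.
Export Order.TTheory GRing.Theory Num.Theory.
Export numFieldNormedType.Exports.

Set Implicit Arguments.
Unset Strict Implicit.
Unset Printing Implicit Defensive.

Local Open Scope classical_set_scope.
Local Open Scope ring_scope.

(* R^n with its topological Borel sigma-algebra. *)
Notation borel_rV R n := (g_sigma_algebraType (@open 'rV[R]_n)).

Definition is_product_measure (R : realType) (n : nat)
    (mus : 'I_n -> probability (measurableTypeR R) R)
    (mu : probability (borel_rV R n) R) : Prop :=
  forall A : 'I_n -> set (measurableTypeR R),
    (forall i, measurable (A i)) ->
    mu [set x : borel_rV R n | forall i, A i ((x : 'rV[R]_n) ord0 i)] =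
    (\prod_(i < n) mus i (A i))%E.

Definition first_coords (R : realType) (n k : nat) (kn : (k <= n)%N)
    (x : borel_rV R n) : borel_rV R k :=
  \row_(i < k) (x : 'rV[R]_n) ord0 (widen_ord kn i).

Lemma measurable_first_coords (R : realType) (n k : nat) (kn : (k <= n)%N) :
  measurable_fun [set: borel_rV R n] (@first_coords R n k kn).
Proof.
apply: (@measurability _ _ (borel_rV R n) (borel_rV R k) _ _ (@open 'rV[R]_k)) => //.
move=> _ [U oU <-]; rewrite setTI; apply: sub_sigma_algebra.
move: U oU; apply/(@continuousP 'rV[R]_n 'rV[R]_k) => x A /nbhs_ballP[e /= e0 eA].
apply/nbhs_ballP; exists e => //= y [_ xy]; apply: eA; split => // i j.
by rewrite /first_coords !mxE; exact: xy.
Qed.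

HB.instance Definition _ (R : realType) (n k : nat) (kn : (k <= n)%N) :=
  isMeasurableFun.Build _ _ _ _ (@first_coords R n k kn)
    (@measurable_first_coords R n k kn).

Definition marginal (R : realType) (n k : nat) (kn : (k <= n)%N)
    (nu : probability (borel_rV R n) R) : probability (borel_rV R k) R :=
  distribution nu (@first_coords R n k kn).

Definition relative_entropy d (T : measurableType d) (R : realType)
    (nu mu : probability T R) : \bar R :=
  if `[< nu `<< mu >]
  then (\int[nu]_x lne (Radon_Nikodym (charge_of_finite_measure nu) mu x))%E
  else +oo%E.

Definition entropy_constraint (R : realType) (n : nat) (Theta : R)
    (gamma : 'I_n -> R) (mu : probability (borel_rV R n) R) :
    set (probability (borel_rV R n) R) :=
  [set nu | forall (k : nat) (kn : (k <= n)%N), (1 <= k)%N ->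
    (relative_entropy (marginal kn nu) (marginal kn mu)
      <= (Theta * ln 2 * \sum_(j < n | (j < k)%N) gamma j)%:E)%E].

Definition ordered_params (R : realType) (n : nat) : set ('I_n -> R) :=
  [set m | (forall i, 0 < m i <= 1) /\
           (forall i j : 'I_n, (i <= j)%N -> m i <= m j)].

Definition append_coord (R : realType) (k : nat) (x : 'rV[R]_k) (y : R) :
    'rV[R]_k.+1 :=
  \row_(i < k.+1) if unlift ord_max i is Some i' then x ord0 i' else y.

(* The passage from P_{k+1} = g to P_k. *)
Definition parisi_step (R : realType) (k : nat)
    (muk : probability (measurableTypeR R) R) (mk : R)
    (g : 'rV[R]_k.+1 -> R) (x : 'rV[R]_k) : R :=
  mk^-1 * ln (\int[muk]_y expR (mk * g (append_coord x y))).

(* P_0 obtained from the terminal condition P_k = g by integrating out the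
   coordinates k, k-1, ..., 1, the last one first. *)
Fixpoint parisi_P0 (R : realType) (k : nat) :
    ('I_k -> probability (measurableTypeR R) R) -> ('I_k -> R) ->
    ('rV[R]_k -> R) -> R :=
  match k with
  | 0 => fun _ _ g => g 0
  | k'.+1 => fun mus m g =>
      parisi_P0 (fun i => mus (widen_ord (leqnSn k') i))
                (fun i => m (widen_ord (leqnSn k') i))
                (parisi_step (mus ord_max) (m ord_max) g)
  end.

Definition parisi_functional (R : realType) (n : nat) (Theta : R)
    (gamma : 'I_n -> R) (mus : 'I_n -> probability (measurableTypeR R) R)
    (phi f : 'rV[R]_n -> R) (Phi : R -> R) (q : R) (m : 'I_n -> R) : R :=
  Phi q - q * derive1 Phi q
  + parisi_P0 mus m (fun x => derive1 Phi q * phi x + f x)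
  + \sum_(k < n) (gamma k * Theta * ln 2 / m k)
  - Theta * ln 2.

Definition bold_Phi (R : realType) (n : nat) (phi f : 'rV[R]_n -> R)
    (Phi : R -> R) (nu : probability (borel_rV R n) R) : R :=
  Phi (\int[nu]_x phi x) + \int[nu]_x f x.

(* Main.v *)
Require Import Defs.
From HB Require Import structures.
From mathcomp Require Import ring lra measurable_realfun.

(* Put [t_k = 1/m_k] and let [H_k] be the entropy of the marginal on the first
   [k] coordinates.  Integrating out one coordinate and applying Gibbs'
   inequality with the density [exp (m_k (P_k - P_(k-1)))] gives, for every [nu],
     [P_0 >= \int P_n dnu - \sum_k t_k (H_k - H_(k-1))],
   with equality for the measure [nu_(q,m)] of density
   [exp (\sum_k m_k (P_k - P_(k-1)))].  Summation by parts and concavity of [Phi]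
   yield [sup <= inf].

   Conversely, the functional attains its minimum at some [(q, t)].  For a
   feasible perturbation [(q', t')], the bound above at [(q, t)] and the equality
   case at [(q', t')], both for [nu' = nu_(q',t')], show that the functional
   linearised at [nu'] does not decrease.  Letting [(q', t')] tend to [(q, t)] gives
   the optimality conditions for [nu = nu_(q,t)]: raising [t_1, ..., t_k]
   gives the entropy constraint for [H_k], contracting [t] towards [1] gives
   complementary slackness, and moving [q] gives [\int phi dnu = q].  Hence [nu]
   is admissible and attains the infimum.  Only continuity of [nu_(q,t)] in
   [(q, t)] is needed, no differentiation under the integral sign. *)

Set Implicit Arguments.
Unset Strict Implicit.
Unset Printing Implicit Defensive.
Local Open Scope classical_set_scope.
Local Open Scope ring_scope.

(** * Borel sets and product measures on row vectors *)

Lemma continuous_measurable_rV (R : realType) n (g : 'rV[R]_n -> R) :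
  continuous g ->
  @measurable_fun _ _ (borel_rV R n) (measurableTypeR R) setT g.
Proof.
move=> cg; apply: (measurability _ (RGenOInfty.measurableE R)) => //.
move=> _ [_ [x ->] <-]; rewrite setTI; apply: sub_sigma_algebra.
by move/continuousP: cg; apply; exact: interval_open.
Qed.

Lemma measurable_rV_coord (R : realType) n (i : 'I_n) :
  @measurable_fun _ _ (borel_rV R n) (measurableTypeR R) setT
    (fun x => (x : 'rV[R]_n) ord0 i).
Proof. by apply: continuous_measurable_rV; exact: coord_continuous. Qed.

(* Every open set is the union of the balls with rational centers and radii
   1/(k+1) that it contains. *)
Lemma measurable_fun_rV (R : realType) n d (T : measurableType d)
    (h : T -> borel_rV R n) :
  (forall i, @measurable_fun _ _ T (measurableTypeR R) setT
     (fun t => (h t : 'rV[R]_n) ord0 i)) ->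
  measurable_fun setT h.
Proof.
move=> mh.
apply: (@measurability _ _ T (borel_rV R n) _ _ (@open 'rV[R]_n)) => //.
move=> _ [U oU <-]; rewrite setTI.
pose B (p : 'rV[rat]_n * nat) : set 'rV[R]_n :=
  [set y | forall i, ball (ratr (p.1 ord0 i) : R) (p.2.+1%:R^-1) (y ord0 i)].
have mB p : measurable (h @^-1` B p).
  rewrite (_ : h @^-1` B p = \bigcap_(i in [set: 'I_n])
     ((fun t => (h t : 'rV[R]_n) ord0 i) @^-1`
       ball (ratr (p.1 ord0 i) : R) (p.2.+1%:R^-1))); last first.
    by apply/seteqP; split => t /= H i; [move=> _|]; exact: H.
  apply: fin_bigcap_measurable; first exact: finite_finset.
  move=> i _; rewrite -[X in measurable X]setTI; apply: (mh i) => //.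
  by apply: open_measurable; exact: ball_open.
rewrite (_ : h @^-1` U =
    \bigcup_(p in [set: 'rV[rat]_n * nat])
      (if `[< B p `<=` U >] then h @^-1` B p else set0)); last first.
  apply/seteqP; split => [t /= Ut|t [p _]]; last first.
    by case: asboolP => // BU Bt; exact: BU.
  have : nbhs (h t : 'rV[R]_n) U by exact: open_nbhs_nbhs.
  move=> /nbhs_ballP[e /= e0 eU].
  (* Half of [e], because the rational center is chosen within [1/(k+1)] of [h t]; every point of
     its cell is then within [2/(k+1) < e] of [h t]. *)
  have [k ke] : exists k, k.+1%:R^-1 < e / 2.
    have e20 : 0 < e / 2 by rewrite divr_gt0.
    have [k] := near_infty_natSinv_lt (PosNum e20).
    by move=> _ /(_ k (leqnn k)) /= ke; exists k.
  have k0 : 0 < k.+1%:R^-1 :> R by rewrite invr_gt0.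
  have /all_sig[c cP] (i : 'I_n) : {c : rat |
      `|ratr c - (h t : 'rV[R]_n) ord0 i| < k.+1%:R^-1}.
    apply: cid; move: ((h t : 'rV[R]_n) ord0 i) => z.
    have /rat_in_itvoo[c] : z - k.+1%:R^-1 < z + k.+1%:R^-1.
      by rewrite ltrBlDr -addrA ltrDl addr_gt0.
    by rewrite in_itv/= => cz; exists c; rewrite ltr_distl.
  exists (\row_i c i, k) => //.
  have tB : B (\row_i c i, k) (h t : 'rV[R]_n).
    by move=> i; rewrite /ball/= mxE; exact: cP.
  case: asboolP => // -[] y By; apply: eU; split => // i j.
  rewrite ord1; have := By j; have := cP j; rewrite /ball/= mxE.
  move: (ratr (c j)) (k.+1%:R^-1) ke => z r; rewrite !ltr_norml => ke /andP[? ?] /andP[? ?].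
  by apply/andP; split; lra.
apply: countable_bigcupT_measurable; first exact: countableP.
by move=> p; case: ifP.
Qed.

Definition boxes (R : realType) n : set (set (borel_rV R n)) :=
  [set B | exists2 A : 'I_n -> set (measurableTypeR R),
     (forall i, measurable (A i)) &
     B = [set x | forall i, A i ((x : 'rV[R]_n) ord0 i)]].

Lemma measurable_box (R : realType) n (A : 'I_n -> set (measurableTypeR R)) :
  (forall i, measurable (A i)) ->
  measurable ([set x | forall i, A i ((x : 'rV[R]_n) ord0 i)] :
    set (borel_rV R n)).
Proof.
move=> mA.
rewrite (_ : [set x | _] = \bigcap_(i in [set: 'I_n])
     ((fun t : borel_rV R n => (t : 'rV[R]_n) ord0 i) @^-1` A i)); last first.
  by apply/seteqP; split => t /= H i; [move=> _|]; exact: H.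
apply: fin_bigcap_measurable; first exact: finite_finset.
move=> i _; rewrite -[X in measurable X]setTI.
exact: measurable_rV_coord.
Qed.

(** The nontrivial inclusion says that the identity, from the sigma-algebra generated by boxes to
    the Borel one, is measurable. By [measurable_fun_rV] it suffices to check coordinates, and the
    preimage of a set under one coordinate is a box. *)
Lemma boxes_generate (R : realType) n :
  (@measurable _ (borel_rV R n)) = <<s @boxes R n >>.
Proof.
apply/seteqP; split; last first.
  by apply: smallest_sub; [exact: sigma_algebra_measurable|
    move=> _ [A mA ->]; exact: measurable_box].
move=> X mX.
pose T := g_sigma_algebraType (@boxes R n).
have mid : @measurable_fun _ _ T (borel_rV R n) setT id.
  apply: measurable_fun_rV => i _ A mA; rewrite setTI.
  apply: sub_sigma_algebra.
  exists (fun j => if j == i then A else setT).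
    by move=> j; case: ifP.
  apply/seteqP; split => x /= => [Ax j|/(_ i)]; last by rewrite eqxx.
  by case: eqP => // ->.
by rewrite -[X]preimage_id -[X in <<s _ >> X]setTI; exact: mid.
Qed.

(** Boxes form a generating family stable under intersection that contains the whole space, so the
    uniqueness theorem for finite measures applies. *)
Lemma measure_rV_unique (R : realType) n
    (m1 m2 : {measure set (borel_rV R n) -> \bar R}) :
  (m1 setT < +oo)%E ->
  (forall A : 'I_n -> set (measurableTypeR R), (forall i, measurable (A i)) ->
     m1 [set x | forall i, A i ((x : 'rV[R]_n) ord0 i)] =
     m2 [set x | forall i, A i ((x : 'rV[R]_n) ord0 i)]) ->
  forall X, measurable X -> m1 X = m2 X.
Proof.
move=> m1oo m12 X mX.
apply: (measure_unique (@boxes R n) (fun _ => setT)) => //.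
- exact: boxes_generate.
- move=> _ _ [A mA ->] [B mB ->]; exists (fun i => A i `&` B i).
    by move=> i; exact: measurableI.
  by apply/seteqP; split => [x /= [Ax Bx] i|x /= H]; [split|split=> i; case: (H i)].
- move=> _; exists (fun=> setT) => //; first by apply/seteqP; split.
- by apply/seteqP; split => // x _; exists 0%N.
- by move=> _ [A mA ->]; exact: m12.
Qed.

Lemma append_coordE (R : realType) k (x : 'rV[R]_k) (y : R) i :
  append_coord x y ord0 (widen_ord (leqnSn k) i) = x ord0 i.
Proof.
rewrite mxE; case: unliftP => [j|] /(congr1 val) /=; last first.
  by move=> H; have := ltn_ord i; rewrite H ltnn.
by rewrite /bump leqNgt ltn_ord add0n => /val_inj ->.
Qed.

Lemma append_coord_max (R : realType) k (x : 'rV[R]_k) (y : R) :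
  append_coord x y ord0 ord_max = y.
Proof. by rewrite mxE unlift_none. Qed.

Lemma measurable_append (R : realType) k :
  @measurable_fun _ _ (borel_rV R k * measurableTypeR R)%type (borel_rV R k.+1)
   setT (fun z => append_coord (z.1 : 'rV[R]_k) z.2).
Proof.
apply: measurable_fun_rV => i.
case: (unliftP ord_max i) => [j|] ->.
  have -> : lift ord_max j = widen_ord (leqnSn k) j.
    by apply: val_inj; rewrite /= /bump leqNgt ltn_ord.
  under eq_fun do rewrite append_coordE.
  by apply: (measurableT_comp (measurable_rV_coord j)); exact: measurable_fst.
under eq_fun do rewrite append_coord_max.
exact: measurable_snd.
Qed.

Lemma first_coords_append (R : realType) k (x : 'rV[R]_k) (y : R) :
  first_coords (leqnSn k) (append_coord x y) = x.
Proof. by apply/rowP => i; rewrite mxE append_coordE. Qed.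

Lemma marginal_product (R : realType) n
  (mus : 'I_n.+1 -> probability (measurableTypeR R) R)
  (mu : probability (borel_rV R n.+1) R) :
  is_product_measure mus mu ->
  is_product_measure (fun i => mus (widen_ord (leqnSn n) i))
    (marginal (leqnSn n) mu).
Proof.
move=> mup A mA; rewrite /marginal/= /distribution/= /pushforward/=.
(* The preimage of the box over [A] is the box with full last side, whose factor in the product is
   1. *)
pose B (i : 'I_n.+1) : set (measurableTypeR R) :=
  if unlift ord_max i is Some j then A j else setT.
have liftE (j : 'I_n) : lift ord_max j = widen_ord (leqnSn n) j.
  by apply: val_inj; rewrite /= /bump leqNgt ltn_ord.
have mB i : measurable (B i) by rewrite /B; case: unlift.
have Bmax : B ord_max = setT by rewrite /B unlift_none.
have Bl j : B (widen_ord (leqnSn n) j) = A j by rewrite /B -liftE liftK.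
have := mup B mB; rewrite big_ord_recr/= Bmax probability_setT mule1.
under eq_bigr do rewrite Bl.
move=> <-; congr (mu _); apply/seteqP; split => x /= H i.
  case: (unliftP ord_max i) => [j|] ->; last by rewrite Bmax.
  by have := H j; rewrite mxE liftE Bl.
by have := H (widen_ord (leqnSn n) i); rewrite mxE Bl.
Qed.

Section append_fubini.
Context (R : realType) (n : nat)
  (mus : 'I_n.+1 -> probability (measurableTypeR R) R)
  (mu : probability (borel_rV R n.+1) R).
Hypothesis mup : is_product_measure mus mu.
Let mu' := marginal (leqnSn n) mu.

(** [mu] is the image of the product of its marginal with the last factor under [append_coord],
    since both measures agree on boxes. Tonelli's theorem then applies. *)
Lemma ge0_integral_append (g : borel_rV R n.+1 -> \bar R) :
  measurable_fun setT g -> (forall x, 0 <= g x)%E ->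
  (\int[mu]_x g x =
   \int[mu']_x \int[mus ord_max]_y g (append_coord (x : 'rV[R]_n) y))%E.
Proof.
move=> mg g0.
pose ap (z : (borel_rV R n * measurableTypeR R)%type) : borel_rV R n.+1 :=
  append_coord (z.1 : 'rV[R]_n) z.2.
have map : measurable_fun setT ap by exact: measurable_append.
pose AP : {mfun _ >-> _} := HB.pack ap (isMeasurableFun.Build _ _ _ _ ap map).
pose m2 := pushforward (mu' \x mus ord_max)%E AP.
have mE X : measurable X -> mu X = m2 X.
  apply: measure_rV_unique => //.
    by rewrite (le_lt_trans (probability_le1 _ measurableT))// ltry.
  move=> A mA; transitivity (\prod_(i < n.+1) mus i (A i))%E; first exact: mup.
  rewrite big_ord_recr/=.
  rewrite /m2 /= /pushforward/=.
  rewrite (_ : _ @^-1` _ = [set x : borel_rV R n | forall i,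
     A (widen_ord (leqnSn n) i) ((x : 'rV[R]_n) ord0 i)] `*` A ord_max); last first.
    apply/seteqP; split => [[x y] /= H|[x y] /= [H1 H2] i].
      split => [i|]; first by have := H (widen_ord (leqnSn n) i); rewrite append_coordE.
      by have := H ord_max; rewrite append_coord_max.
    case: (unliftP ord_max i) => [j|] ->; last by rewrite append_coord_max.
    have -> : lift ord_max j = widen_ord (leqnSn n) j.
      by apply: val_inj; rewrite /= /bump leqNgt ltn_ord.
    by rewrite append_coordE.
  rewrite product_measure1E//; last first.
    by apply: (@measurable_box R n (fun i => A (widen_ord (leqnSn n) i))).
  by congr (_ * _)%E; rewrite -(marginal_product mup).
rewrite (eq_measure_integral m2); last by move=> X mX _; exact: mE.
rewrite ge0_integral_pushforward//= preimage_setT fubini_tonelli1//=.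
exact: measurableT_comp.
Qed.

End append_fubini.

(** * Densities and relative entropy *)

Section density.
Context d (T : measurableType d) (R : realType).
Implicit Types (mu nu : probability T R) (D g u : T -> R).

(** The density is real-valued and nonnegative everywhere, whereas the derivative in
    [relative_entropy] is extended-real and determined only up to null sets. *)
Definition has_density nu mu D :=
  [/\ measurable_fun setT D, forall x, 0 <= D x &
      forall A, measurable A -> nu A = (\int[mu]_(x in A) (D x)%:E)%E].

Lemma bounded_integrable mu u (C : R) :
  measurable_fun setT u -> (forall x, `|u x| <= C) ->
  mu.-integrable setT (EFin \o u).
Proof.
move=> mf uC; apply: measurable_bounded_integrable => //.
  by rewrite (le_lt_trans (probability_le1 _ measurableT))// ltry.
exists C; split; first exact: num_real.
by move=> x Cx y _ /=; rewrite (le_trans (uC y))// ltW.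
Qed.

Lemma Rintegral_prob_cst mu (C : R) : \int[mu]_x C = C.
Proof.
rewrite Rintegral_cst// -[RHS]mulr1; congr (_ * _).
exact: (congr1 fine (probability_setT mu)).
Qed.

Lemma Rintegral_le_cst mu u (C : R) : mu.-integrable setT (EFin \o u) ->
  (forall x, u x <= C) -> \int[mu]_x u x <= C.
Proof.
move=> iu uC; rewrite -[leRHS](Rintegral_prob_cst mu); apply: le_Rintegral => //.
by apply: (@bounded_integrable _ _ `|C|).
Qed.

Lemma Rintegral_ge_cst mu u (C : R) : mu.-integrable setT (EFin \o u) ->
  (forall x, C <= u x) -> C <= \int[mu]_x u x.
Proof.
move=> iu uC; rewrite -[leLHS](Rintegral_prob_cst mu); apply: le_Rintegral => //.
by apply: (@bounded_integrable _ _ `|C|).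
Qed.

Lemma Rintegral_norm_le mu u (C : R) : measurable_fun setT u ->
  (forall x, `|u x| <= C) -> `|\int[mu]_x u x| <= C.
Proof.
move=> mf uC; have iu := bounded_integrable mu mf uC.
rewrite ler_norml Rintegral_ge_cst ?Rintegral_le_cst// => x;
  by have := uC x; rewrite ler_norml => /andP[].
Qed.

Lemma density_dominates nu mu D : has_density nu mu D -> nu `<< mu.
Proof.
move=> [mD D0 nuD]; apply/null_content_dominatesP => A mA muA.
by rewrite nuD// null_set_integral//; apply/measurable_funTS/measurable_EFinP.
Qed.

(** The real logarithm has a default value at 0 where [lne] is [-oo]. This lemma confines the
    discrepancy to a [nu]-null set. *)
Lemma density_ae_gt0 nu mu D : has_density nu mu D ->
  {ae nu, forall x, 0 < D x}.
Proof.
move=> [mD D0 nuD].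
have mA : measurable (D @^-1` `]-oo, 0]).
  by rewrite -[X in measurable X]setTI; apply: mD.
exists (D @^-1` `]-oo, 0]); split => //.
  rewrite nuD//; apply: integral0_eq => x /=; rewrite in_itv/= => Dx.
  by congr EFin; apply/eqP; rewrite eq_le Dx D0.
by move=> x /=; rewrite in_itv/= leNgt => /negP.
Qed.

Lemma density_ae_RN nu mu D : has_density nu mu D ->
  ae_eq mu setT (Radon_Nikodym (charge_of_finite_measure nu) mu) (EFin \o D).
Proof.
move=> nuD; have dom := density_dominates nuD; case: nuD => [mD D0 nuD].
apply: integral_ae_eq => //; first exact: Radon_Nikodym_integrable.
  exact/measurable_EFinP.
by move=> E _ mE; rewrite -Radon_Nikodym_integral//= -nuD.
Qed.

Lemma ge0_integral_density nu mu D (f : T -> \bar R) :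
  has_density nu mu D -> measurable_fun setT f -> (forall x, 0 <= f x)%E ->
  (\int[nu]_x f x = \int[mu]_x (f x * (D x)%:E))%E.
Proof.
move=> nuD mf f0; have dom := density_dominates nuD.
have aeD := density_ae_RN nuD.
rewrite -(Radon_Nikodym_SigmaFinite.change_of_variables dom)//.
have mRN : measurable_fun setT (Radon_Nikodym_SigmaFinite.f nu mu).
  exact: measurable_int (Radon_Nikodym_SigmaFinite.f_integrable dom).
case: nuD => [mD D0 nuD].
apply: ge0_ae_eq_integral => //.
- exact: emeasurable_funM.
- by apply: emeasurable_funM => //; exact/measurable_EFinP.
- by move=> x _; rewrite mule_ge0// Radon_Nikodym_SigmaFinite.f_ge0.
- by move=> x _; rewrite mule_ge0// lee_fin.
- apply: ae_eqe_mul2l; apply: ae_eq_trans aeD.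
  exact: ae_eq_Radon_Nikodym_SigmaFinite.
Qed.

Lemma Rintegral_density nu mu D u : has_density nu mu D ->
  nu.-integrable setT (EFin \o u) ->
  \int[nu]_x u x = \int[mu]_x (u x * D x).
Proof.
move=> nuD iu; have dom := density_dominates nuD.
have aeD := density_ae_RN nuD; case: nuD => [mD D0 nuD].
rewrite /Rintegral -(Radon_Nikodym_change_of_variables dom)//; congr fine.
have mu' := measurable_int _ iu.
apply: ae_eq_integral => //.
- by apply: emeasurable_funM => //.
- by apply/measurable_EFinP/measurable_funM => //; exact/measurable_EFinP.
- under [X in ae_eq _ _ _ X]eq_fun do rewrite EFinM.
  exact: ae_eqe_mul2l.
Qed.

Lemma relative_entropyE nu mu D : has_density nu mu D ->
  relative_entropy nu mu = (\int[nu]_x (ln (D x))%:E)%E.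
Proof.
move=> nuD; have dom := density_dominates nuD.
rewrite /relative_entropy asboolT//.
set RN := Radon_Nikodym _ _.
have mRN : measurable_fun setT (fine \o RN).
  have iRN : mu.-integrable setT RN by exact: Radon_Nikodym_integrable.
  by apply: measurableT_comp => //; exact: measurable_int iRN.
apply: ae_eq_integral => //.
(* Measurability of [lne \o RN] is read off branch by branch, the real logarithm being
   measurable. *)
- rewrite (_ : (fun x => lne (RN x)) = (fun x => if fine (RN x) <= 0 then -oo%E
      else (ln (fine (RN x)))%:E)); last first.
    apply/funext => x; have : RN x \is a fin_num by exact: Radon_Nikodym_fin_num.
    by case: (RN x).
  apply: measurable_fun_ifT => //.
  + by apply: measurable_fun_ler.
  + by apply/measurable_EFinP; apply: measurableT_comp => //; exact: measurable_ln.
- by case: nuD => mD _ _; apply/measurable_EFinP/measurableT_comp => //; exact: measurable_ln.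
- have := null_dominates_ae_eq measurableT dom (density_ae_RN nuD).
  apply: filterS2 (density_ae_gt0 nuD) => x D0 /(_ I) RND _.
  by rewrite /RN RND; exact: lne_EFin.
Qed.

Lemma dominated_density nu mu : nu `<< mu -> exists D, has_density nu mu D.
Proof.
move=> dom; exists (fine \o Radon_Nikodym_SigmaFinite.f nu mu); split.
- apply: measurableT_comp => //.
  exact: measurable_int (Radon_Nikodym_SigmaFinite.f_integrable dom).
- by move=> x /=; rewrite fine_ge0// Radon_Nikodym_SigmaFinite.f_ge0.
- move=> A mA; rewrite (Radon_Nikodym_SigmaFinite.f_integral dom)//.
  by apply: eq_integral => x _ /=; rewrite fineK// Radon_Nikodym_SigmaFinite.f_fin_num.
Qed.

Lemma entropy_lty_dominates nu mu :
  (relative_entropy nu mu < +oo)%E -> nu `<< mu.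
Proof. by rewrite /relative_entropy; case: asboolP. Qed.

Lemma measurable_ln_density nu mu D : has_density nu mu D ->
  measurable_fun setT (fun x => ln (D x)).
Proof. by case=> mD _ _; apply: measurableT_comp => //; exact: measurable_ln. Qed.

(** The left-hand side is the integral of [g / D] against [nu], hence that of [g] over [{D > 0}]
    against [mu]. The part of [g] on [{D = 0}] is lost, so only an inequality holds. *)
Lemma integral_inv_density_le nu mu D g : has_density nu mu D ->
  measurable_fun setT g -> (forall x, 0 <= g x) ->
  (\int[nu]_x (g x * expR (- ln (D x)))%:E <= \int[mu]_x (g x)%:E)%E.
Proof.
move=> nuD mg g0; have mL := measurable_ln_density nuD.
have mE : measurable_fun setT (fun x => g x * expR (- ln (D x))).
  apply: measurable_funM => //; apply: measurableT_comp => //.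
  exact: measurable_funN.
rewrite (ge0_integral_density nuD)//; last 2 first.
- exact/measurable_EFinP.
- by move=> x; rewrite lee_fin mulr_ge0// expR_ge0.
case: nuD => [mD D0 _]; apply: ge0_le_integral => //.
- by move=> x _; rewrite mule_ge0// lee_fin// mulr_ge0// expR_ge0.
- by apply: emeasurable_funM; exact/measurable_EFinP.
- exact/measurable_EFinP.
move=> x _; rewrite -EFinM lee_fin -mulrA -[leRHS]mulr1 ler_wpM2l//.
have := D0 x; rewrite le_eqVlt => /predU1P[<-|Dx]; first by rewrite mulr0.
by rewrite expRN lnK ?posrE// mulVf// gt_eqF.
Qed.

(** The negative part of [ln D] is at most [exp (- ln D)], whose [nu]-integral is at most 1 by the
    previous lemma with [g = 1]. A finite entropy then forces the positive part to be integrable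
    too. *)
Lemma integrable_ln_density nu mu D : has_density nu mu D ->
  (relative_entropy nu mu < +oo)%E ->
  nu.-integrable setT (EFin \o (fun x => ln (D x))).
Proof.
move=> nuD; have mL := measurable_ln_density nuD.
rewrite (relative_entropyE nuD).
set f := EFin \o (fun x => ln (D x)); rewrite -/(integral nu setT f) => foo.
have mf : measurable_fun setT f by exact/measurable_EFinP.
have f1 : (\int[nu]_x f^\- x <= 1)%E.
  have := integral_inv_density_le nuD (measurable_cst (1 : measurableTypeR R)) (fun _ => ler01).
  rewrite [X in (_ <= X)%E](_ : _ = 1%E); last first.
    rewrite (integral_cst _ measurableT 1) mul1e; exact: probability_setT.
  apply: le_trans.
  apply: ge0_le_integral => //.
  - exact: measurable_funeneg.
  - apply/measurable_EFinP; under eq_fun do rewrite mul1r.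
    by apply: measurableT_comp => //; exact: measurable_funN.
  - move=> x _; rewrite mul1r /f funenegE/= -EFin_max lee_fin ge_max expR_ge0 andbT.
    by apply: le_trans (expR_ge1Dx _); rewrite lerDr.
have fn : (\int[nu]_x f^\- x \is a fin_num)%E.
  by rewrite ge0_fin_numE ?integral_ge0// (le_lt_trans f1)// ltry.
have fp : (\int[nu]_x f^\+ x < +oo)%E.
  rewrite ltey; apply/eqP => fpoo; move: foo.
  rewrite [X in (X < _)%E]integralE fpoo -(fineK fn) /=.
  by rewrite ltxx.
apply/integrableP; split => //.
rewrite -[X in integral _ _ X]/(abse \o f) fune_abse ge0_integralD//.
- by rewrite lte_add_pinfty// -ge0_fin_numE ?integral_ge0.
- exact: measurable_funepos.
- exact: measurable_funeneg.
Qed.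

Lemma entropy_fineE nu mu D : has_density nu mu D ->
  fine (relative_entropy nu mu) = \int[nu]_x ln (D x).
Proof. by move=> nuD; rewrite (relative_entropyE nuD). Qed.

Lemma entropy_fin_num nu mu : (relative_entropy nu mu < +oo)%E ->
  relative_entropy nu mu \is a fin_num.
Proof.
move=> Hoo; have [D nuD] := dominated_density (entropy_lty_dominates Hoo).
rewrite (relative_entropyE nuD).
exact: integrable_fin_num (integrable_ln_density nuD Hoo).
Qed.

(** Integrate [1 + x <= exp x] at [x = u - ln D] against [nu]: the right-hand side becomes the
    integral of [g / D], which is at most 1. The relation [g = exp u] is asked only almost
    everywhere because [g] will vanish on a [nu]-null set. *)
Lemma gibbs_inequality nu mu D u g : has_density nu mu D ->
  (relative_entropy nu mu < +oo)%E ->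
  nu.-integrable setT (EFin \o u) ->
  measurable_fun setT g -> (forall x, 0 <= g x) ->
  (\int[mu]_x (g x)%:E <= 1)%E ->
  {ae nu, forall x, g x = expR (u x)} ->
  \int[nu]_x u x <= fine (relative_entropy nu mu).
Proof.
move=> nuD Hoo iu mg g0 g1 gu; rewrite (entropy_fineE nuD).
have iL := integrable_ln_density nuD Hoo.
have mL := measurable_ln_density nuD.
have mu' : measurable_fun setT u by apply/measurable_EFinP; exact: measurable_int iu.
have mEx : measurable_fun setT (fun x => expR (u x - ln (D x))).
  by apply: measurableT_comp => //; apply: measurable_funB.
have EE : (\int[nu]_x (expR (u x - ln (D x)))%:E <= 1)%E.
  apply: le_trans g1; apply: le_trans (integral_inv_density_le nuD mg g0).
  rewrite le_eqVlt; apply/orP; left; apply/eqP.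
  apply: ge0_ae_eq_integral => //.
  - exact/measurable_EFinP.
  - apply/measurable_EFinP/measurable_funM => //; apply: measurableT_comp => //.
    exact: measurable_funN.
  - by move=> x _; rewrite lee_fin mulr_ge0// expR_ge0.
  - by apply: filterS gu => x -> _; rewrite expRD.
have iE : nu.-integrable setT (EFin \o (fun x => expR (u x - ln (D x)))).
  apply/integrableP; split; first exact/measurable_EFinP.
  under eq_integral do rewrite /= ger0_norm ?expR_ge0//.
  by rewrite (le_lt_trans EE)// ltry.
have E1 : \int[nu]_x expR (u x - ln (D x)) <= 1.
  rewrite -lee_fin /Rintegral fineK//.
  by apply: integrable_fin_num iE.
have i1 : nu.-integrable setT (EFin \o cst (1:R)).
  by apply: (@bounded_integrable _ _ 1) => // x; rewrite normr1.
have iB : nu.-integrable setT (EFin \o (fun x => u x - ln (D x))).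
  have := integrableB measurableT iu iL.
  by apply: eq_integrable.
rewrite -subr_le0 -RintegralB// -(lerD2r 1) add0r; apply: le_trans E1.
rewrite -[X in _ + X](Rintegral_prob_cst nu).
rewrite -RintegralD//; apply: le_Rintegral => //.
  have := integrableD measurableT iB i1.
  by apply: eq_integrable.
by move=> x _ /=; rewrite addrC; exact: expR_ge1Dx.
Qed.

Lemma density_exists mu D : measurable_fun setT D -> (forall x, 0 <= D x) ->
  (\int[mu]_x (D x)%:E = 1)%E -> exists nu, has_density nu mu D.
Proof.
move=> mD D0 D1; have mDE : measurable_fun setT (EFin \o D) by exact/measurable_EFinP.
pose m (A : set T) := (\int[mu]_(x in A) (EFin \o D) x)%E.
have m0 : m set0 = 0%E by rewrite /m integral_set0.
have mge0 A : (0 <= m A)%E by apply: integral_ge0 => x _; rewrite lee_fin.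
have msa : semi_sigma_additive m.
  by apply: semi_sigma_additive_nng_induced => // x; rewrite lee_fin.
pose M : {measure set T -> \bar R} :=
  HB.pack m (isMeasure.Build _ _ _ m m0 mge0 msa).
have M1 : M setT = 1%E by [].
pose P : probability T R := HB.pack (@Measure.sort _ _ _ M)
  (Measure_isProbability.Build _ _ _ M M1).
by exists P; split.
Qed.

End density.

(** * The Parisi recursion *)

Section bounded_measurable.
Context (R : realType).

(** The bound is explicit because [parisi_step] preserves it, so that a single constant serves all
    levels of the recursion. *)
Definition bmeas k (C : R) (g : 'rV[R]_k -> R) :=
  @measurable_fun _ _ (borel_rV R k) (measurableTypeR R) setT g /\
  forall x, `|g x| <= C.

Lemma bmeas_integrable k C (g : 'rV[R]_k -> R)
    (nu : probability (borel_rV R k) R) :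
  bmeas C g -> nu.-integrable setT (EFin \o g).
Proof. by move=> [mg gC]; apply: (@bounded_integrable _ (borel_rV R k) _ _ _ C). Qed.

Lemma bmeas_ge0 k C (g : 'rV[R]_k -> R) : bmeas C g -> 0 <= C.
Proof. by move=> [_ /(_ 0)]; exact: le_trans. Qed.

Lemma bmeas_first k C (g : 'rV[R]_k -> R) :
  bmeas C g -> bmeas C (fun x : 'rV[R]_k.+1 => g (first_coords (leqnSn k) x)).
Proof.
move=> [mg gC]; split => //.
exact: (measurableT_comp mg (measurable_first_coords _)).
Qed.

Lemma bmeas_append k C (g : 'rV[R]_k.+1 -> R) (x : 'rV[R]_k) : bmeas C g ->
  @measurable_fun _ _ (measurableTypeR R) (measurableTypeR R) setT
    (fun y => g (append_coord x y)).
Proof.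
move=> [mg _]; apply: (measurableT_comp mg).
exact: (measurableT_comp (@measurable_append R k)
  (@measurable_pair1 _ _ (borel_rV R k) (measurableTypeR R) x)).
Qed.

Lemma bmeas_lin k (a b C1 C2 : R) (g1 g2 : 'rV[R]_k -> R) :
  bmeas C1 g1 -> bmeas C2 g2 ->
  bmeas (`|a| * C1 + `|b| * C2) (fun x => a * g1 x + b * g2 x).
Proof.
move=> [mg1 g1C] [mg2 g2C]; split.
  by apply: measurable_funD; apply: measurable_funM.
by move=> x; rewrite (le_trans (ler_normD _ _))// !normrM lerD// ler_wpM2l.
Qed.

Lemma bmeas_scale k (a C : R) (g : 'rV[R]_k -> R) :
  bmeas C g -> bmeas (`|a| * C) (fun x => a * g x).
Proof.
move=> [mg gC]; split; first exact: measurable_funM.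
by move=> x; rewrite normrM ler_wpM2l.
Qed.

Lemma bmeas_le k C C' (g : 'rV[R]_k -> R) : C <= C' -> bmeas C g -> bmeas C' g.
Proof. by move=> CC [mg gC]; split => // x; exact: le_trans CC. Qed.

End bounded_measurable.

(** * The functional [u |-> ln \int exp u] and one step of the recursion *)

Section log_integral_exp.
Context d (T : measurableType d) (R : realType) (P : probability T R).
Implicit Types u v : T -> R.

Lemma integrable_expR u C : measurable_fun setT u -> (forall y, `|u y| <= C) ->
  P.-integrable setT (EFin \o (fun y => expR (u y))).
Proof.
move=> mu uC; apply: (@bounded_integrable _ _ _ _ _ (expR C)).
  exact: measurableT_comp.
move=> y; rewrite ger0_norm ?expR_ge0// ler_expR.
by rewrite (le_trans (ler_norm _))//.
Qed.

Lemma integral_expR_gt0 u C : measurable_fun setT u ->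
  (forall y, `|u y| <= C) -> 0 < \int[P]_y expR (u y).
Proof.
move=> mu uC; apply: (@lt_le_trans _ _ (expR (- C))); first exact: expR_gt0.
apply: Rintegral_ge_cst; first exact: integrable_expR uC.
by move=> y; rewrite ler_expR; have := uC y; rewrite ler_norml => /andP[].
Qed.

(** The functional is monotone and commutes with adding constants; hence it is 1-Lipschitz for the
    sup norm. *)
Lemma ln_integral_expR_le u v (C e : R) :
  measurable_fun setT u -> (forall y, `|u y| <= C) ->
  measurable_fun setT v -> (forall y, `|v y| <= C) ->
  (forall y, u y <= v y + e) ->
  ln (\int[P]_y expR (u y)) <= ln (\int[P]_y expR (v y)) + e.
Proof.
move=> mu uC mv vC uv.
have u0 := integral_expR_gt0 mu uC; have v0 := integral_expR_gt0 mv vC.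
have iv := integrable_expR mv vC.
rewrite -[X in _ + X]expRK -lnM ?posrE ?expR_gt0//.
rewrite ler_ln ?posrE ?mulr_gt0 ?expR_gt0// -RintegralZr//.
apply: le_Rintegral => //; first exact: integrable_expR uC.
  have := integrableZr measurableT (expR e) iv.
  by apply: eq_integrable.
by move=> y _; rewrite -expRD ler_expR.
Qed.

Lemma ln_integral_expR_dist u v (C e : R) :
  measurable_fun setT u -> (forall y, `|u y| <= C) ->
  measurable_fun setT v -> (forall y, `|v y| <= C) ->
  (forall y, `|u y - v y| <= e) ->
  `|ln (\int[P]_y expR (u y)) - ln (\int[P]_y expR (v y))| <= e.
Proof.
move=> mu uC mv vC uv.
have := @ln_integral_expR_le u v C e mu uC mv vC.
have := @ln_integral_expR_le v u C e mv vC mu uC.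
move=> H1 H2; rewrite ler_distl lerBlDr; apply/andP; split.
- by apply: H1 => y; have := uv y; rewrite ler_distl lerBlDr => /andP[].
- by apply: H2 => y; have := uv y; rewrite ler_distl lerBlDr => /andP[].
Qed.

Lemma ln_integral_expR_norm u (C : R) :
  measurable_fun setT u -> (forall y, `|u y| <= C) ->
  `|ln (\int[P]_y expR (u y))| <= C.
Proof.
move=> mu uC; rewrite -[X in `|X|]subr0.
rewrite -[X in _ - X](_ : ln (\int[P]_y expR (cst 0 y)) = 0).
  apply: (@ln_integral_expR_dist _ _ C) => // y; rewrite ?normr0 ?subr0//.
  exact: le_trans (uC y).
by rewrite /= expR0 Rintegral_prob_cst ln1.
Qed.

End log_integral_exp.

Section parisi_step_theory.
Context (R : realType) (k : nat) (muk : probability (measurableTypeR R) R).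
Implicit Types (m t C : R) (g : 'rV[R]_k.+1 -> R).

Lemma mul_parisi_step m g x : m != 0 ->
  m * parisi_step muk m g x =
  ln (\int[muk]_y expR (m * g (append_coord x y))).
Proof. by move=> m0; rewrite /parisi_step mulrA divff// mul1r. Qed.

Let scaled_bound m C g (x : 'rV[R]_k) : bmeas C g ->
  measurable_fun setT (fun y => m * g (append_coord x y)) /\
  forall y, `|m * g (append_coord x y)| <= `|m| * C.
Proof.
move=> gC; split; first by apply: measurable_funM => //; exact: bmeas_append gC.
by move=> y; rewrite normrM ler_wpM2l//; exact: gC.2.
Qed.

Lemma parisi_step_norm m C g x : 0 < m -> bmeas C g ->
  `|parisi_step muk m g x| <= C.
Proof.
move=> m0 gC; have [mm mC] := scaled_bound m x gC.
have := ln_integral_expR_norm muk mm mC.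
by rewrite -mul_parisi_step ?gt_eqF// normrM ler_pM2l// normr_gt0 gt_eqF.
Qed.

Lemma bmeas_parisi_step m C g : 0 < m -> bmeas C g ->
  bmeas C (parisi_step muk m g).
Proof.
move=> m0 gC; split; last by move=> x; exact: parisi_step_norm.
have mE : measurable_fun setT (fun z : borel_rV R k * measurableTypeR R =>
    (expR (m * g (append_coord (z.1 : 'rV[R]_k) z.2)))%:E).
  apply/measurable_EFinP; apply: measurableT_comp => //.
  apply: measurable_funM => //.
  exact: (measurableT_comp gC.1 (@measurable_append R k)).
apply: measurable_funM => //.
apply: measurableT_comp; first exact: measurable_ln.
rewrite /Rintegral; apply: measurableT_comp => //.
apply: (measurable_fun_fubini_tonelli_F (m2 := muk) _ mE).
by move=> z; rewrite lee_fin expR_ge0.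
Qed.

(** One step is Lipschitz jointly in [t = 1/m] and [g], with a constant independent of [t]. Changing
    the exponent costs [e + e * C], changing the prefactor costs another [e * C]. *)
Lemma parisi_step_dist t t' C (e : R) g g' x : 1 <= t -> 1 <= t' ->
  bmeas C g -> bmeas C g' -> (forall y, `|g y - g' y| <= e) ->
  `|t - t'| <= e ->
  `|parisi_step muk t^-1 g x - parisi_step muk t'^-1 g' x| <= (1 + 2 * C) * e.
Proof.
move=> t1 t1' gC gC' gg' tt'.
have C0 := bmeas_ge0 gC.
have t0 : 0 < t by apply: lt_le_trans t1.
have t0' : 0 < t' by apply: lt_le_trans t1'.
have [mm mC] := scaled_bound t^-1 x gC.
have [mm' mC'] := scaled_bound t'^-1 x gC'.
have inv_norm (s : R) : 1 <= s -> `|s^-1| = s^-1.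
  by move=> s1; rewrite ger0_norm// invr_ge0 (le_trans ler01).
have leC (s : R) : 1 <= s -> `|s^-1| * C <= C.
  move=> s1; have s0 : 0 < s by apply: lt_le_trans s1.
  by rewrite inv_norm// ler_piMl// invf_le1.
(* The factor [1/t] is kept because the estimate is multiplied by [t] at the end. *)
have V : `|t^-1 - t'^-1| <= e / t.
  rewrite (_ : t^-1 - t'^-1 = (t' - t) / t' / t); last first.
    by field; rewrite !gt_eqF.
  rewrite normrM inv_norm// ler_pM2r ?invr_gt0//.
  rewrite normrM distrC inv_norm//.
  by rewrite ler_pdivrMr// (le_trans tt')// ler_peMr// (le_trans _ tt').
pose e' := (e + e * C) / t.
have D : forall y, `|t^-1 * g (append_coord x y) - t'^-1 * g' (append_coord x y)| <= e'.
  move=> y; set a := g _; set b := g' _.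
  have -> : t^-1 * a - t'^-1 * b = t^-1 * (a - b) + (t^-1 - t'^-1) * b by ring.
  rewrite (le_trans (ler_normD _ _))// !normrM /e' mulrDl lerD//.
    by rewrite inv_norm// mulrC ler_pM2r ?invr_gt0//; exact: gg'.
  by rewrite mulrAC ler_pM//; exact: gC'.2.
have := @ln_integral_expR_dist _ _ _ muk _ _ C e' mm _ mm' _ D.
move=> /(_ (fun y => le_trans (mC y) (leC _ t1)) (fun y => le_trans (mC' y) (leC _ t1'))).
rewrite -!mul_parisi_step ?invr_eq0 ?gt_eqF//.
have := parisi_step_norm x (_ : 0 < t'^-1) gC'; rewrite invr_gt0 => /(_ t0').
set b := parisi_step _ _ _ _; set a := parisi_step _ _ _ _ => bC ab.
have -> : a - b = t * (t^-1 * a - t'^-1 * b) + (t - t') / t' * b.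
  by field; rewrite !gt_eqF.
have e0 : 0 <= e by apply: le_trans tt'.
have -> : (1 + 2 * C) * e = t * e' + e * C.
  by rewrite /e'; field; rewrite gt_eqF.
rewrite (le_trans (ler_normD _ _))// lerD//.
  by rewrite normrM gtr0_norm// ler_pM2l.
rewrite normrM ler_pM// normrM.
by rewrite inv_norm// ler_pdivrMr// (le_trans tt')// ler_peMr.
Qed.

End parisi_step_theory.

(** * Disintegration along the last coordinate and the variational bound *)

Section parisi_disintegration.
Context (R : realType) (k : nat)
  (mus : 'I_k.+1 -> probability (measurableTypeR R) R)
  (mu : probability (borel_rV R k.+1) R).
Hypothesis mup : is_product_measure mus mu.
Let mu' := marginal (leqnSn k) mu.
Let fst : 'rV[R]_k.+1 -> 'rV[R]_k := first_coords (leqnSn k).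
Let T m (g : 'rV[R]_k.+1 -> R) := parisi_step (mus ord_max) m g.

(* [expR (m * (g x - T m g (fst x)))] is a probability density in the last
   coordinate. *)
Lemma integral_parisi_density (m C : R) (g : 'rV[R]_k.+1 -> R)
    (w : 'rV[R]_k -> R) : 0 < m -> bmeas C g ->
  @measurable_fun _ _ (borel_rV R k) (measurableTypeR R) setT w ->
  (forall x, 0 <= w x) ->
  (\int[mu]_x (w (fst x) * expR (m * (g x - T m g (fst x))))%:E =
   \int[mu']_x (w x)%:E)%E.
Proof.
move=> m0 gC mw w0.
have [mT TC] := bmeas_parisi_step (mus ord_max) m0 gC.
rewrite (ge0_integral_append mup); last 2 first.
- apply/measurable_EFinP/measurable_funM.
    exact: (measurableT_comp mw (measurable_first_coords _)).
  apply: measurableT_comp => //; apply: measurable_funM => //.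
  apply: measurable_funB; first exact: gC.1.
  exact: (measurableT_comp mT (measurable_first_coords _)).
- by move=> x; rewrite lee_fin mulr_ge0// expR_ge0.
apply: eq_integral => x _.
have mm : measurable_fun setT (fun y => m * g (append_coord (x : 'rV[R]_k) y)).
  by apply: measurable_funM => //; exact: bmeas_append gC.
have mC y : `|m * g (append_coord (x : 'rV[R]_k) y)| <= `|m| * C.
  by rewrite normrM ler_wpM2l//; exact: gC.2.
have iE := integrable_expR (mus ord_max) mm mC.
have I0 := integral_expR_gt0 (mus ord_max) mm mC.
under eq_integral => y _.
  rewrite /fst first_coords_append mulrBr mul_parisi_step ?gt_eqF//.
  rewrite expRD expRN lnK ?posrE// mulrA mulrAC EFinM.
  over.
rewrite /= (integralZl measurableT iE).
rewrite -[X in (_ * X)%E]fineK; last exact: integrable_fin_num iE.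
by rewrite -EFinM mulfVK// gt_eqF.
Qed.

End parisi_disintegration.

(* [\sum_j t_j (H_j - H_(j-1))], where [H_j] is the entropy of the marginals on
   the first [j] coordinates. *)
Fixpoint weighted_entropy (R : realType) (k : nat) : ('I_k -> R) ->
    probability (borel_rV R k) R -> probability (borel_rV R k) R -> R :=
  match k with
  | 0 => fun _ _ _ => 0
  | k'.+1 => fun t nu mu =>
      t ord_max * (fine (relative_entropy nu mu) -
        fine (relative_entropy (marginal (leqnSn k') nu)
                               (marginal (leqnSn k') mu))) +
      weighted_entropy (fun i => t (widen_ord (leqnSn k') i))
        (marginal (leqnSn k') nu) (marginal (leqnSn k') mu)
  end.

(** Guarantees that no [fine] in [weighted_entropy] turns an infinite entropy into the default value
    0. *)
Fixpoint finite_entropies (R : realType) (k : nat) :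
    probability (borel_rV R k) R -> probability (borel_rV R k) R -> Prop :=
  match k with
  | 0 => fun nu mu => (relative_entropy nu mu < +oo)%E
  | k'.+1 => fun nu mu => (relative_entropy nu mu < +oo)%E /\
      finite_entropies (marginal (leqnSn k') nu) (marginal (leqnSn k') mu)
  end.

(* [\sum_j (P_j - P_(j-1)) / t_j], the log-density of the optimal measure. *)
Fixpoint gibbs_log_density (R : realType) (k : nat) :
    ('I_k -> probability (measurableTypeR R) R) -> ('I_k -> R) ->
    ('rV[R]_k -> R) -> 'rV[R]_k -> R :=
  match k with
  | 0 => fun _ _ _ _ => 0
  | k'.+1 => fun mus t g x =>
      let Tg := parisi_step (mus ord_max) (t ord_max)^-1 g in
      let x' : 'rV[R]_k' := first_coords (leqnSn k') x in
      gibbs_log_density (fun i => mus (widen_ord (leqnSn k') i))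
        (fun i => t (widen_ord (leqnSn k') i)) Tg x' +
      (t ord_max)^-1 * (g x - Tg x')
  end.

Section entropy_induction.
Context (R : realType).

Lemma finite_entropies_lty k (nu mu : probability (borel_rV R k) R) :
  finite_entropies nu mu -> (relative_entropy nu mu < +oo)%E.
Proof. by case: k nu mu => // k nu mu []. Qed.

Lemma Rintegral_marginal k C (h : 'rV[R]_k -> R)
    (nu : probability (borel_rV R k.+1) R) : bmeas C h ->
  \int[marginal (leqnSn k) nu]_x h x =
  \int[nu]_x h (first_coords (leqnSn k) x).
Proof.
move=> hC; rewrite /Rintegral; congr fine; apply: integral_distribution.
  by apply/measurable_EFinP; exact: hC.1.
exact: (bmeas_integrable nu (bmeas_first hC)).
Qed.

(** A conditional Gibbs inequality. The competing density is that of the marginal of [nu] times the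
    conditional density [exp (m (g - Tg))] of the last coordinate; its logarithm integrates to the
    entropy of the marginal plus the left-hand side. *)
Lemma parisi_step_entropy k (mus : 'I_k.+1 -> probability (measurableTypeR R) R)
    (mu nu : probability (borel_rV R k.+1) R) (m C : R) (g : 'rV[R]_k.+1 -> R) :
  is_product_measure mus mu -> 0 < m -> bmeas C g ->
  (relative_entropy nu mu < +oo)%E ->
  (relative_entropy (marginal (leqnSn k) nu) (marginal (leqnSn k) mu) < +oo)%E ->
  m * (\int[nu]_x g x -
    \int[marginal (leqnSn k) nu]_x parisi_step (mus ord_max) m g x) <=
  fine (relative_entropy nu mu) -
  fine (relative_entropy (marginal (leqnSn k) nu) (marginal (leqnSn k) mu)).
Proof.
move=> mup m0 gC Hoo Hoo'.
set nu' := marginal (leqnSn k) nu in Hoo' *.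
set mu' := marginal (leqnSn k) mu in Hoo' *.
have [D nuD] := dominated_density (entropy_lty_dominates Hoo).
have [D' nuD'] := dominated_density (entropy_lty_dominates Hoo').
have TC := bmeas_parisi_step (mus ord_max) m0 gC.
set Tg := parisi_step _ _ _ in TC *.
pose fst : borel_rV R k.+1 -> borel_rV R k := first_coords (leqnSn k).
have mfst : measurable_fun setT fst := measurable_first_coords _.
have iL := integrable_ln_density nuD' Hoo'.
have mL := measurable_ln_density nuD'.
have iLf : nu.-integrable setT (EFin \o (fun x => ln (D' (fst x)))).
  apply/integrableP; split; first by apply/measurable_EFinP/(measurableT_comp mL).
  case/integrableP : iL => _; apply: le_lt_trans.
  rewrite /nu' (ge0_integral_distribution _ (f := fun x => `|(ln (D' x))%:E|%E))//.
  by apply: measurableT_comp => //; exact/measurable_EFinP.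
have gTC : bmeas (`|m| * C + `|- m| * C) (fun x => m * g x + - m * Tg (fst x)).
  by apply: (@bmeas_lin _ _ m (- m) C C _ _ gC (bmeas_first TC)).
have igT := bmeas_integrable nu gTC.
pose u x := ln (D' (fst x)) + (m * g x + - m * Tg (fst x)).
have iu : nu.-integrable setT (EFin \o u).
  by have := integrableD measurableT iLf igT; apply: eq_integrable.
pose w x := D' (fst x) * expR (m * (g x - Tg (fst x))).
have mw : measurable_fun setT w.
  apply: measurable_funM; first by case: nuD' => mD' _ _; exact: measurableT_comp.
  apply: measurableT_comp => //; apply: measurable_funM => //.
  by apply: measurable_funB; [exact: gC.1|exact: (bmeas_first TC).1].
have w0 x : 0 <= w x by case: nuD' => _ D'0 _; rewrite mulr_ge0 ?expR_ge0.
have w1 : (\int[mu]_x (w x)%:E <= 1)%E.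
  case: nuD' => mD' D'0 nuD'.
  rewrite (integral_parisi_density mup m0 gC mD' D'0).
  have := nuD' _ measurableT; rewrite -/mu' => <-.
  exact: probability_le1.
(* The two differ only where [D'] vanishes, a null set for the marginal, whose preimage is null for
   [nu]. *)
have wu : {ae nu, forall x, w x = expR (u x)}.
  have [A [mA A0 sA]] := density_ae_gt0 nuD'.
  exists (fst @^-1` A); split; first by rewrite -[X in measurable X]setTI; exact: mfst.
    exact: A0.
  move=> x /= wx; apply: sA => /= D'x; apply: wx.
  by rewrite /w /u expRD lnK ?posrE// mulrBr mulNr.
have := gibbs_inequality nuD Hoo iu mw w0 w1 wu.
clearbody Tg.
rewrite RintegralD//.
have -> : \int[nu]_x ln (D' (fst x)) = fine (relative_entropy nu' mu').
  rewrite (relative_entropyE nuD') /nu'; congr fine.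
  symmetry; apply: integral_distribution => //; exact/measurable_EFinP.
have -> : \int[nu]_x (m * g x + - m * Tg (fst x)) =
    m * (\int[nu]_x g x - \int[nu']_x Tg x).
  rewrite RintegralD//; last 2 first.
  - exact: (bmeas_integrable nu (bmeas_scale m gC)).
  - exact: (bmeas_integrable nu (bmeas_scale (- m) (bmeas_first TC))).
  rewrite !RintegralZl//; last 2 first.
  - exact: (bmeas_integrable nu (bmeas_first TC)).
  - exact: (bmeas_integrable nu gC).
  by rewrite (Rintegral_marginal nu TC); ring.
by rewrite lerBrDl.
Qed.

(** [R^0] is a single point, so the constant 1 is a density. This gives [H_0 = 0] at the bottom of
    all inductions. *)
Lemma relative_entropy_rV0 (nu mu : probability (borel_rV R 0) R) :
  relative_entropy nu mu = 0%E.
Proof.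
have D : has_density nu mu (fun=> 1).
  split => // A mA; rewrite (integral_cst mu mA 1) mul1e.
  have [->|/set0P[x Ax]] := eqVneq A set0; first by rewrite !measure0.
  have -> : A = setT.
    apply/seteqP; split => // y _.
    by rewrite (_ : y = x)//; apply/rowP => -[].
  by rewrite (probability_setT nu); exact: (esym (probability_setT mu)).
by rewrite (relative_entropyE D) ln1; exact: integral0.
Qed.

(** Induction from the last coordinate: multiply [parisi_step_entropy] by [t_k = 1/m_k] and continue
    with the marginal of [nu] and the function [P_(k-1)]. *)
Lemma parisi_P0_ge k (mus : 'I_k -> probability (measurableTypeR R) R)
    (mu nu : probability (borel_rV R k) R) (t : 'I_k -> R) (C : R)
    (g : 'rV[R]_k -> R) :
  is_product_measure mus mu -> (forall i, 0 < t i) -> bmeas C g ->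
  finite_entropies nu mu ->
  \int[nu]_x g x - weighted_entropy t nu mu <=
  parisi_P0 mus (fun i => (t i)^-1) g.
Proof.
elim: k mus mu nu t g => [|k IH] mus mu nu t g mup t0 gC.
  move=> _ /=; rewrite subr0 (@eq_Rintegral _ _ _ nu setT (cst (g 0))).
    by rewrite Rintegral_prob_cst.
  by move=> x _ /=; congr g; apply/rowP => -[].
move=> /= [Hoo fin].
have m0 : 0 < (t ord_max)^-1 by rewrite invr_gt0.
have TC := bmeas_parisi_step (mus ord_max) m0 gC.
have := IH _ _ _ (fun i => t (widen_ord (leqnSn k) i)) _
  (marginal_product mup) (fun i => t0 _) TC fin.
apply: le_trans.
have := parisi_step_entropy mup m0 gC Hoo (finite_entropies_lty fin).
rewrite mulrC ler_pdivrMr//.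
by move=> H; rewrite opprD addrA lerD2r lerBlDr -lerBlDl [leRHS]mulrC.
Qed.

(** Since [t >= 1], each level adds at most [2 * C]. The bound is uniform in the parameters, as the
    Lipschitz estimates below require. *)
Lemma bmeas_gibbs_log_density k (C : R) : exists B : R,
  forall mus (t : 'I_k -> R) g, (forall i, 1 <= t i) -> bmeas C g ->
    bmeas B (gibbs_log_density mus t g).
Proof.
elim: k C => [|n IH] C.
  by exists 0 => mus t g _ _; split => //= x; rewrite normr0.
have [B BP] := IH C; exists (B + (C + C)) => mus t g t1 gC.
have tmax0 : 0 < t ord_max by apply: lt_le_trans (t1 _).
have m0 : 0 < (t ord_max)^-1 by rewrite invr_gt0.
have TC := bmeas_parisi_step (mus ord_max) m0 gC.
have LB := BP (fun i => mus (widen_ord (leqnSn n) i)) _ _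
  (fun i => t1 (widen_ord (leqnSn n) i)) TC.
have m1 : `|(t ord_max)^-1| * C <= C.
  by rewrite gtr0_norm// ler_piMl ?(bmeas_ge0 gC)// invf_le1.
split=> /=.
  apply: measurable_funD; first exact: (bmeas_first LB).1.
  apply: measurable_funM => //.
  by apply: measurable_funB; [exact: gC.1|exact: (bmeas_first TC).1].
move=> x; rewrite (le_trans (ler_normD _ _))// lerD//; first exact: LB.2.
rewrite mulrBr (le_trans (ler_normB _ _))// lerD//; apply: le_trans m1.
  exact: (bmeas_scale _ gC).2.
exact: (bmeas_scale _ TC).2.
Qed.

(** The density is a product of conditional densities, integrated out one coordinate at a time. *)
Lemma integral_gibbs_density k (mus : 'I_k -> probability (measurableTypeR R) R)
    (mu : probability (borel_rV R k) R) (t : 'I_k -> R) (C : R)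
    (g : 'rV[R]_k -> R) :
  is_product_measure mus mu -> (forall i, 1 <= t i) -> bmeas C g ->
  (\int[mu]_x (expR (gibbs_log_density mus t g x))%:E = 1)%E.
Proof.
elim: k mus mu t g => [|k IH] mus mu t g mup t1 gC /=.
  rewrite expR0 (integral_cst mu measurableT 1) mul1e.
  exact: probability_setT.
have tmax0 : 0 < t ord_max by apply: lt_le_trans (t1 _).
have m0 : 0 < (t ord_max)^-1 by rewrite invr_gt0.
have TC := bmeas_parisi_step (mus ord_max) m0 gC.
have [B BP] := bmeas_gibbs_log_density k C.
have [mL _] := BP (fun i => mus (widen_ord (leqnSn k) i)) _ _
  (fun i => t1 (widen_ord (leqnSn k) i)) TC.
under eq_integral do rewrite expRD.
rewrite (integral_parisi_density mup m0 gC (w := fun x => expR (gibbs_log_density _ _ _ x))).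
- by apply: IH => //; exact: marginal_product.
- exact: measurableT_comp.
- by move=> x; exact: expR_ge0.
Qed.

(** Integrating out the last conditional density leaves a density of the same shape with [P_(k-1)]
    as terminal function, so inductions can pass to the marginal. *)
Lemma marginal_gibbs_density k (mus : 'I_k.+1 -> probability (measurableTypeR R) R)
    (mu nu : probability (borel_rV R k.+1) R) (t : 'I_k.+1 -> R) (C : R)
    (g : 'rV[R]_k.+1 -> R) :
  is_product_measure mus mu -> (forall i, 1 <= t i) -> bmeas C g ->
  has_density nu mu (fun x => expR (gibbs_log_density mus t g x)) ->
  has_density (marginal (leqnSn k) nu) (marginal (leqnSn k) mu) (fun x =>
    expR (gibbs_log_density (fun i => mus (widen_ord (leqnSn k) i))
      (fun i => t (widen_ord (leqnSn k) i))
      (parisi_step (mus ord_max) (t ord_max)^-1 g) x)).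
Proof.
move=> mup t1 gC [_ _ nuD].
have tmax0 : 0 < t ord_max by apply: lt_le_trans (t1 _).
have m0 : 0 < (t ord_max)^-1 by rewrite invr_gt0.
have TC := bmeas_parisi_step (mus ord_max) m0 gC.
have [B BP] := bmeas_gibbs_log_density k C.
have [mL _] := BP (fun i => mus (widen_ord (leqnSn k) i)) _ _
  (fun i => t1 (widen_ord (leqnSn k) i)) TC.
have mE : measurable_fun setT (fun x : borel_rV R k =>
  expR (gibbs_log_density (fun i => mus (widen_ord (leqnSn k) i))
      (fun i => t (widen_ord (leqnSn k) i))
      (parisi_step (mus ord_max) (t ord_max)^-1 g) x)).
  exact: measurableT_comp.
split; [exact: mE|by move=> x; exact: expR_ge0|move=> A mA].
rewrite -[LHS]/(nu (first_coords (leqnSn k) @^-1` A)) nuD; last first.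
  by rewrite -[X in measurable X]setTI; exact: measurable_first_coords.
pose L' := gibbs_log_density (fun i => mus (widen_ord (leqnSn k) i))
  (fun i => t (widen_ord (leqnSn k) i))
  (parisi_step (mus ord_max) (t ord_max)^-1 g).
(* The indicator goes into the weight, so that [integral_parisi_density] computes the mass of
   [A]. *)
pose w (x : 'rV[R]_k) := expR (L' x) * \1_A x.
transitivity (\int[marginal (leqnSn k) mu]_x (w x)%:E)%E; last first.
  rewrite [RHS]integral_mkcond; apply: eq_integral => x _.
  by rewrite /w patchE indicE; case: ifP => _; rewrite ?mulr1 ?mulr0.
rewrite -(integral_parisi_density mup m0 gC (w := w)).
- rewrite [LHS]integral_mkcond; apply: eq_integral => x _.
  rewrite /w patchE indicE /= expRD.
  have -> : (x \in first_coords (leqnSn k) @^-1` A) =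
    (first_coords (leqnSn k) x \in A) by [].
  by case: ifP => _; rewrite ?mulr1 ?mulr0 ?mul0r.
- by apply: measurable_funM => //; exact: measurable_indic.
- by move=> x; rewrite /w mulr_ge0 ?expR_ge0.
Qed.

Lemma entropy_bounded_density k (mu nu : probability (borel_rV R k) R) (B : R)
    (L : 'rV[R]_k -> R) : bmeas B L ->
  has_density nu mu (fun x => expR (L x)) ->
  relative_entropy nu mu = (\int[nu]_x L x)%:E.
Proof.
move=> LB D; rewrite (relative_entropyE D).
under eq_integral do rewrite expRK.
rewrite /Rintegral fineK//; exact: (integrable_fin_num measurableT (bmeas_integrable nu LB)).
Qed.

(** Equality case of [parisi_P0_ge]: the log-densities of [nu] and of its marginal differ by
    [(P_k - P_(k-1)) / t_k], so [t_k (H_k - H_(k-1))] is exactly the integral of [P_k - P_(k-1)]. *)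
Lemma parisi_P0_gibbs k (mus : 'I_k -> probability (measurableTypeR R) R)
    (mu nu : probability (borel_rV R k) R) (t : 'I_k -> R) (C : R)
    (g : 'rV[R]_k -> R) :
  is_product_measure mus mu -> (forall i, 1 <= t i) -> bmeas C g ->
  has_density nu mu (fun x => expR (gibbs_log_density mus t g x)) ->
  finite_entropies nu mu /\
  \int[nu]_x g x - weighted_entropy t nu mu =
  parisi_P0 mus (fun i => (t i)^-1) g.
Proof.
elim: k mus mu nu t g => [|k IH] mus mu nu t g mup t1 gC nuD.
  split; first by rewrite /= relative_entropy_rV0 ltry.
  rewrite /= subr0 (@eq_Rintegral _ _ _ nu setT (cst (g 0))).
    by rewrite Rintegral_prob_cst.
  by move=> x _ /=; congr g; apply/rowP => -[].
have tmax0 : 0 < t ord_max by apply: lt_le_trans (t1 _).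
have m0 : 0 < (t ord_max)^-1 by rewrite invr_gt0.
have TC := bmeas_parisi_step (mus ord_max) m0 gC.
have nuD' := marginal_gibbs_density mup t1 gC nuD.
have [fin eqP0] := IH _ _ _ _ _ (marginal_product mup)
   (fun i => t1 (widen_ord (leqnSn k) i)) TC nuD'.
have [B BP] := bmeas_gibbs_log_density k.+1 C.
have LB := BP mus t g t1 gC.
have [B' BP'] := bmeas_gibbs_log_density k C.
have LB' := BP' (fun i => mus (widen_ord (leqnSn k) i)) _ _
  (fun i => t1 (widen_ord (leqnSn k) i)) TC.
have HE := entropy_bounded_density LB nuD.
have HE' := entropy_bounded_density LB' nuD'.
split; first by split => //; rewrite HE ltry.
rewrite /= -eqP0 HE HE' /=.
rewrite (Rintegral_marginal nu LB') (Rintegral_marginal nu TC).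
have iL' := bmeas_integrable nu (bmeas_first LB').
have iT := bmeas_integrable nu (bmeas_first TC).
have ig := bmeas_integrable nu gC.
have igT : nu.-integrable setT (EFin \o (fun x : 'rV[R]_k.+1 => g x -
    parisi_step (mus ord_max) (t ord_max)^-1 g (first_coords (leqnSn k) x))).
  by have := integrableB measurableT ig iT; apply: eq_integrable.
rewrite RintegralD//; last first.
  by have := integrableZl measurableT (t ord_max)^-1 igT; apply: eq_integrable.
rewrite RintegralZl// RintegralB//.
by field; rewrite gt_eqF.
Qed.

End entropy_induction.

(** * Entropies of marginals and summation by parts *)

Section marginals.
Context (R : realType).

(** Once the set functions coincide, the remaining fields of the two structures are proofs,
    identified by proof irrelevance. *)
Lemma eq_probability d (T : measurableType d) (p q : probability T R) :
  (forall A, p A = q A) -> p = q.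
Proof.
move=> /funext; case: p => p [p1 p2 p3 p4 p5 p6 p7]; case: q => q [q1 q2 q3 q4 q5 q6 q7] /= pq.
subst q.
have E1 : p1 = q1 by clear; case: p1; case: q1 => *; f_equal; exact: Prop_irrelevance.
subst q1.
have E2 : p2 = q2 by clear; case: p2; case: q2 => *; f_equal; exact: Prop_irrelevance.
have E3 : p3 = q3 by clear; case: p3; case: q3 => *; f_equal; exact: Prop_irrelevance.
have E4 : p4 = q4 by clear; case: p4; case: q4 => *; f_equal; exact: Prop_irrelevance.
have E5 : p5 = q5 by clear; case: p5; case: q5 => *; f_equal; exact: Prop_irrelevance.
have E6 : p6 = q6 by clear; case: p6; case: q6 => *; f_equal; exact: Prop_irrelevance.
have E7 : p7 = q7 by clear; case: p7; case: q7 => *; f_equal; exact: Prop_irrelevance.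
by rewrite E2 E3 E4 E5 E6 E7.
Qed.

Lemma marginal_id n (kn : (n <= n)%N) (nu : probability (borel_rV R n) R) :
  marginal kn nu = nu.
Proof.
apply: eq_probability => A; rewrite /marginal/= /distribution/= /pushforward/=.
congr (nu _); apply/seteqP; rewrite /preimage/=.
have E x : first_coords kn x = x.
  by apply/rowP => i; rewrite mxE; congr (x _ _); exact: val_inj.
by split => x /=; rewrite E.
Qed.

Lemma marginal_comp n k (kn : (k <= n)%N) (kn1 : (k <= n.+1)%N)
    (nu : probability (borel_rV R n.+1) R) :
  marginal kn (marginal (leqnSn n) nu) = marginal kn1 nu.
Proof.
apply: eq_probability => A; rewrite /marginal/= /distribution/= /pushforward/=.
congr (nu _).
have E x : first_coords kn (first_coords (leqnSn n) x) = first_coords kn1 x.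
  by apply/rowP => i; rewrite !mxE; congr (x _ _); exact: val_inj.
by apply/seteqP; split => x /=; rewrite E.
Qed.

(** Connects the recursive condition with the form used in [entropy_constraint]; the level [k = 0],
    absent there, is covered by [H_0 = 0]. *)
Lemma finite_entropies_marginal n (nu mu : probability (borel_rV R n) R) :
  finite_entropies nu mu <->
  forall k (kn : (k <= n)%N), (1 <= k)%N ->
    (relative_entropy (marginal kn nu) (marginal kn mu) < +oo)%E.
Proof.
elim: n nu mu => [|n IH] nu mu.
  split; first by move=> _ k k0 k1; have := leq_trans k1 k0.
  by move=> _ /=; rewrite relative_entropy_rV0 ltry.
split => [[/= H fin] k kn k1|H].
  have := kn; rewrite leq_eqVlt => /predU1P[E|]; first by subst k; rewrite !marginal_id.
  rewrite ltnS => kn'; rewrite -!(marginal_comp kn').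
  by move/IH : fin; exact.
split; first by have := H n.+1 (leqnn _) isT; rewrite !marginal_id.
by apply/IH => k kn k1; rewrite !(marginal_comp _ (leqW kn)); exact: H.
Qed.

Lemma weighted_entropyD n (s d : 'I_n -> R) (e : R)
    (nu mu : probability (borel_rV R n) R) :
  weighted_entropy (fun i => s i + e * d i) nu mu =
  weighted_entropy s nu mu + e * weighted_entropy d nu mu.
Proof.
elim: n s d nu mu => [|n IH] s d nu mu /=; first by rewrite mulr0 addr0.
by rewrite IH; ring.
Qed.

(** The increments [H_j - H_(j-1)] with [j <= k] telescope, and [H_0 = 0]. *)
Lemma weighted_entropy_indic n k (kn : (k <= n)%N)
    (nu mu : probability (borel_rV R n) R) :
  weighted_entropy (fun i : 'I_n => (i < k)%:R) nu mu =
  fine (relative_entropy (marginal kn nu) (marginal kn mu)).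
Proof.
elim: n k kn nu mu => [|n IH] k kn nu mu /=.
  by case: k kn => // kn; rewrite relative_entropy_rV0.
have := kn; rewrite leq_eqVlt => /predU1P[E|kn'].
  subst k; rewrite ltnS leqnn mul1r !marginal_id.
  rewrite (_ : (fun i : 'I_n => _) = (fun i : 'I_n => (i < n)%:R)).
    by rewrite (IH _ (leqnn n)) !marginal_id subrK.
  by apply/funext => i; rewrite !ltn_ord ltnW ?ltnS.
rewrite ltnS in kn'; rewrite ltnNge kn' mul0r add0r.
by rewrite (IH _ kn') !(marginal_comp _ kn).
Qed.

(** Summation by parts gives each [H_k] the nonnegative coefficient [t_k - t_(k+1)], with [s]
    playing the part of [t_(n+1)]; the bounds on [H_k] can then be inserted. A free [s] lets the
    induction use the last weight as the lower bound for the others. *)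
Lemma weighted_entropy_abel n (c t : 'I_n -> R) (s : R)
    (nu mu : probability (borel_rV R n) R) :
  (forall k (kn : (k <= n)%N), (1 <= k)%N ->
    fine (relative_entropy (marginal kn nu) (marginal kn mu)) <=
    \sum_(j < n | (j < k)%N) c j) ->
  (forall i, s <= t i) -> (forall i j : 'I_n, (i <= j)%N -> t j <= t i) ->
  weighted_entropy t nu mu - s * fine (relative_entropy nu mu) <=
  \sum_(i < n) c i * t i - s * \sum_(i < n) c i.
Proof.
elim: n c t s nu mu => [|n IH] c t s nu mu H st tdec.
  by rewrite /= relative_entropy_rV0 !big_ord0.
have H' k (kn : (k <= n)%N) : (1 <= k)%N ->
    fine (relative_entropy (marginal kn (marginal (leqnSn n) nu))
      (marginal kn (marginal (leqnSn n) mu))) <=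
    \sum_(j < n | (j < k)%N) c (widen_ord (leqnSn n) j).
  move=> k1; rewrite !(marginal_comp _ (leqW kn)); apply: le_trans (H _ _ k1) _.
  by rewrite big_mkcond big_ord_recr/= ltnNge kn addr0 -big_mkcond.
have := IH _ (fun i => t (widen_ord (leqnSn n) i)) (t ord_max) _ _ H'
  (fun i => tdec (widen_ord (leqnSn n) i) ord_max (ltnW (ltn_ord i)))
  (fun i j ij => tdec (widen_ord (leqnSn n) i) (widen_ord (leqnSn n) j) ij).
have := H n.+1 (leqnn _) isT; rewrite !marginal_id.
under eq_bigl do rewrite ltn_ord.
rewrite !big_ord_recr /=.
set h := fine (relative_entropy nu mu); set h' := fine _.
set W := weighted_entropy _ _ _; set S := \sum_(i < n) _; set S' := \sum_(i < n) _.
move=> h1 h2; have h3 := ler_wpM2l (_ : 0 <= t ord_max - s) h1.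
have := h3; rewrite subr_ge0 => /(_ (st _)) {h3}; move: h2; clear; nra.
Qed.

End marginals.

(** * Lipschitz dependence of the Gibbs measures on the parameters *)

Section gibbs_lipschitz.
Context (R : realType).

Lemma gibbs_lipschitz k (C : R) : exists2 K : R, 0 <= K &
  forall mus (t t' : 'I_k -> R) g g' (e : R), (forall i, 1 <= t i) ->
    (forall i, 1 <= t' i) -> bmeas C g -> bmeas C g' ->
    (forall i, `|t i - t' i| <= e) -> (forall x, `|g x - g' x| <= e) ->
    `|parisi_P0 mus (fun i => (t i)^-1) g -
      parisi_P0 mus (fun i => (t' i)^-1) g'| <= K * e /\
    forall x, `|gibbs_log_density mus t g x - gibbs_log_density mus t' g' x|
      <= K * e.
Proof.
elim: k => [|k [K K0 KP]].
  exists 1 => // mus t t' g g' e _ _ _ _ _ gg'; split; first by rewrite mul1r /=.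
  by move=> x /=; rewrite subr0 normr0 mul1r (le_trans _ (gg' x)).
(* The lower levels see a perturbation enlarged by [1 + 2 * C]. The last term of the log-density
   contributes [e + (1 + 2 * C) * e] through [g] and [Tg], and [2 * C * e] through [1/t]. *)
pose K' := K * (1 + 2 * `|C|) + (2 + 4 * `|C|).
exists K'; first by rewrite /K' addr_ge0 ?mulr_ge0 ?addr_ge0 ?mulr_ge0.
move=> mus t t' g g' e t1 t1' gC gC' tt' gg'.
have C0 := bmeas_ge0 gC; rewrite /K' (ger0_norm C0) {K'}.
have e0 : 0 <= e by apply: le_trans (gg' 0).
have ge1_gt0 (s : R) : 1 <= s -> 0 < s^-1 by move=> ?; rewrite invr_gt0 (lt_le_trans ltr01).
have TC := bmeas_parisi_step (mus ord_max) (ge1_gt0 _ (t1 ord_max)) gC.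
have TC' := bmeas_parisi_step (mus ord_max) (ge1_gt0 _ (t1' ord_max)) gC'.
have TT := parisi_step_dist (mus ord_max) _ (t1 ord_max) (t1' ord_max) gC gC' gg' (tt' _).
have ee : e <= (1 + 2 * C) * e by rewrite mulrDl mul1r lerDl !mulr_ge0.
have [P LL] := KP (fun i => mus (widen_ord (leqnSn k) i)) _ _ _ _ ((1 + 2 * C) * e)
  (fun i => t1 (widen_ord (leqnSn k) i)) (fun i => t1' (widen_ord (leqnSn k) i))
  TC TC' (fun i => le_trans (tt' (widen_ord (leqnSn k) i)) ee) TT.
rewrite mulrDl -[K * (1 + 2 * C) * e]mulrA.
split; first by apply: le_trans P _; rewrite lerDl mulr_ge0// addr_ge0// mulr_ge0.
move=> x /=; set Lx := gibbs_log_density _ _ _ _; set Lx' := gibbs_log_density _ _ _ _.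
have LLx : `|Lx - Lx'| <= K * ((1 + 2 * C) * e) by exact: LL.
set y := first_coords _ x.
have := TT y; have := TC'.2 y; have := gC'.2 x; have := gg' x; have := tt' ord_max.
have := t1 ord_max; have := t1' ord_max.
move: (t ord_max) (t' ord_max) (g x) (g' x)
  (parisi_step (mus ord_max) (t ord_max)^-1 g y)
  (parisi_step (mus ord_max) (t' ord_max)^-1 g' y).
move=> s s' b b' a a' s1' s1 ss bb b'C a'C aa.
have s0 : 0 < s by apply: lt_le_trans s1.
have s0' : 0 < s' by apply: lt_le_trans s1'.
have -> : Lx + s^-1 * (b - a) - (Lx' + s'^-1 * (b' - a')) =
  (Lx - Lx') + (s^-1 * ((b - b') - (a - a')) + (s' - s) * (s^-1 * s'^-1 * (b' - a'))).
  by field; rewrite !gt_eqF.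
rewrite (le_trans (ler_normD _ _))// lerD// (le_trans (ler_normD _ _))//.
have -> : (2 + 4 * C) * e = (e + (1 + 2 * C) * e) + e * (C + C) by ring.
have inv1 (r : R) : 1 <= r -> `|r^-1| <= 1.
  by move=> r1; rewrite gtr0_norm ?ge1_gt0// invf_le1// (lt_le_trans ltr01).
apply: lerD.
  rewrite normrM -[leRHS]mul1r ler_pM// ?inv1//.
  by rewrite (le_trans (ler_normB _ _))// lerD.
rewrite normrM distrC ler_pM// normrM -[leRHS]mul1r ler_pM//.
  by rewrite normrM -[leRHS]mul1r ler_pM// inv1.
by rewrite (le_trans (ler_normB _ _))// lerD.
Qed.

(** The tangent inequality at [x] gives [exp x - exp y <= exp x * (x - y)]; then exchange the two
    points. *)
Lemma expR_dist (a b B : R) : a <= B -> b <= B ->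
  `|expR a - expR b| <= expR B * `|a - b|.
Proof.
have H (x y : R) : x <= B -> expR x - expR y <= expR B * `|x - y|.
  move=> xB; have := expR_ge1Dx (y - x); rewrite expRD expRN => H.
  have : expR x * (1 + (y - x)) <= expR y.
    rewrite -[leRHS](mulfVK (lt0r_neq0 (expR_gt0 x))) mulrC.
    by rewrite ler_pM2r ?expR_gt0.
  move=> H'; apply: (@le_trans _ _ (expR x * (x - y))); first by lra.
  apply: (@le_trans _ _ (expR x * `|x - y|)); first by rewrite ler_wpM2l ?expR_ge0// ler_norm.
  by rewrite ler_wpM2r// ler_expR.
move=> aB bB; rewrite ler_norml H// andbT.
by rewrite lerNl opprB (distrC a b) H.
Qed.

Lemma Rintegral_density_dist k (mu nu nu' : probability (borel_rV R k) R)
    (L L' h : 'rV[R]_k -> R) (B A e : R) :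
  has_density nu mu (fun x => expR (L x)) ->
  has_density nu' mu (fun x => expR (L' x)) ->
  bmeas B L -> bmeas B L' -> (forall x, `|L x - L' x| <= e) -> bmeas A h ->
  `|\int[nu]_x h x - \int[nu']_x h x| <= A * (expR B * e).
Proof.
move=> nuD nuD' LB LB' LL hA; have A0 := bmeas_ge0 hA.
have eb (l : 'rV[R]_k -> R) : bmeas B l -> bmeas (A * expR B) (fun x => h x * expR (l x)).
  move=> [ml lB]; split.
    by apply: measurable_funM; [exact: hA.1|exact: measurableT_comp].
  move=> x; rewrite normrM ler_pM ?hA.2// ger0_norm ?expR_ge0// ler_expR.
  by rewrite (le_trans (ler_norm _))//.
rewrite (Rintegral_density nuD (bmeas_integrable nu hA)).
rewrite (Rintegral_density nuD' (bmeas_integrable nu' hA)).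
rewrite -RintegralB//; last 2 first.
- exact: (bmeas_integrable mu (eb _ LB)).
- exact: (bmeas_integrable mu (eb _ LB')).
apply: Rintegral_norm_le.
  by apply: measurable_funB; [exact: (eb _ LB).1|exact: (eb _ LB').1].
move=> x; rewrite -mulrBr normrM ler_pM ?hA.2//.
have le_B (l : 'rV[R]_k -> R) : bmeas B l -> l x <= B.
  by move=> lB; rewrite (le_trans (ler_norm _))// lB.2.
rewrite (le_trans (expR_dist (le_B _ LB) (le_B _ LB')))//.
by rewrite ler_wpM2l ?expR_ge0.
Qed.

(** The weights [s] are fixed while the Gibbs measure moves. Induction over the marginals, which are
    Gibbs measures for parameters at distance at most [(1 + 2 * C) * e]; the first conclusion
    supplies the entropy of the marginal in the inductive step. *)
Lemma weighted_entropy_lipschitz k (C : R) (s : 'I_k -> R) : exists2 K : R, 0 <= K &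
  forall mus (mu nu nu' : probability (borel_rV R k) R) (t t' : 'I_k -> R) g g' (e : R),
    is_product_measure mus mu ->
    (forall i, 1 <= t i) -> (forall i, 1 <= t' i) ->
    bmeas C g -> bmeas C g' ->
    has_density nu mu (fun x => expR (gibbs_log_density mus t g x)) ->
    has_density nu' mu (fun x => expR (gibbs_log_density mus t' g' x)) ->
    (forall i, `|t i - t' i| <= e) -> (forall x, `|g x - g' x| <= e) ->
    `|fine (relative_entropy nu mu) - fine (relative_entropy nu' mu)| <= K * e /\
    `|weighted_entropy s nu mu - weighted_entropy s nu' mu| <= K * e.
Proof.
have entropy_lip n : exists2 K : R, 0 <= K &
  forall mus (mu nu nu' : probability (borel_rV R n) R) (t t' : 'I_n -> R) g g' (e : R),
    (forall i, 1 <= t i) -> (forall i, 1 <= t' i) -> bmeas C g -> bmeas C g' ->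
    has_density nu mu (fun x => expR (gibbs_log_density mus t g x)) ->
    has_density nu' mu (fun x => expR (gibbs_log_density mus t' g' x)) ->
    (forall i, `|t i - t' i| <= e) -> (forall x, `|g x - g' x| <= e) ->
    `|fine (relative_entropy nu mu) - fine (relative_entropy nu' mu)| <= K * e.
  have [B BP] := bmeas_gibbs_log_density n C.
  have [K K0 KP] := gibbs_lipschitz n C.
  exists (K + `|B| * (expR B * K)); first by rewrite addr_ge0// !mulr_ge0 ?expR_ge0.
  move=> mus mu nu nu' t t' g g' e t1 t1' gC gC' nuD nuD' tt' gg'.
  have LB := BP mus t g t1 gC; have LB' := BP mus t' g' t1' gC'.
  have [_ LL] := KP mus t t' g g' e t1 t1' gC gC' tt' gg'.
  have B0 := bmeas_ge0 LB; rewrite (ger0_norm B0).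
  rewrite (entropy_bounded_density LB nuD) (entropy_bounded_density LB' nuD') /=.
  set I := \int[nu]_x _; set J := \int[nu']_x _.
  (* The measure is changed first, under a fixed integrand; then the integrand, under a fixed
     measure. *)
  have -> : I - J = (I - \int[nu']_x gibbs_log_density mus t g x) +
    (\int[nu']_x gibbs_log_density mus t g x - J) by ring.
  rewrite (le_trans (ler_normD _ _))// addrC mulrDl lerD//.
    rewrite -RintegralB//; last 2 first.
    - exact: bmeas_integrable LB.
    - exact: bmeas_integrable LB'.
    by apply: Rintegral_norm_le => //; apply: measurable_funB; [exact: LB.1|exact: LB'.1].
  rewrite -mulrA -[expR B * K * e]mulrA.
  exact: (Rintegral_density_dist nuD nuD' LB LB' LL LB).
elim: k s => [|k IH] s.
  have [K K0 KP] := entropy_lip 0%N; exists K => //.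
  move=> mus mu nu nu' t t' g g' e _ t1 t1' gC gC' nuD nuD' tt' gg'.
  have H := KP _ _ _ _ _ _ _ _ _ t1 t1' gC gC' nuD nuD' tt' gg'.
  split => //.
  by rewrite /= subr0 normr0; apply: le_trans H.
have [K K0 KP] := entropy_lip k.+1.
have [W W0 WP] := IH (fun i => s (widen_ord (leqnSn k) i)).
have D0 : 0 <= 1 + 2 * `|C| by rewrite addr_ge0// mulr_ge0.
exists (K + (`|s ord_max| * (K + W * (1 + 2 * `|C|)) + W * (1 + 2 * `|C|))).
  by rewrite !addr_ge0// !mulr_ge0// addr_ge0// mulr_ge0.
move=> mus mu nu nu' t t' g g' e mup t1 t1' gC gC' nuD nuD' tt' gg'.
have C0 := bmeas_ge0 gC; rewrite (ger0_norm C0) in D0 *.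
have e0 : 0 <= e by apply: le_trans (gg' 0).
have H := KP _ _ _ _ _ _ _ _ _ t1 t1' gC gC' nuD nuD' tt' gg'.
have ge1_gt0 (r : R) : 1 <= r -> 0 < r^-1 by move=> ?; rewrite invr_gt0 (lt_le_trans ltr01).
have TC := bmeas_parisi_step (mus ord_max) (ge1_gt0 _ (t1 ord_max)) gC.
have TC' := bmeas_parisi_step (mus ord_max) (ge1_gt0 _ (t1' ord_max)) gC'.
have TT := parisi_step_dist (mus ord_max) _ (t1 ord_max) (t1' ord_max) gC gC' gg' (tt' _).
have ee : e <= (1 + 2 * C) * e by rewrite mulrDl mul1r lerDl !mulr_ge0.
have nD := marginal_gibbs_density mup t1 gC nuD.
have nD' := marginal_gibbs_density mup t1' gC' nuD'.
have [H1 H2] := WP _ _ _ _ _ _ _ _ ((1 + 2 * C) * e) (marginal_product mup)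
  (fun i => t1 (widen_ord (leqnSn k) i)) (fun i => t1' (widen_ord (leqnSn k) i))
  TC TC' nD nD'
  (fun i => le_trans (tt' (widen_ord (leqnSn k) i)) ee) TT.
have X0 : 0 <= K * e by rewrite mulr_ge0.
have Y0 : 0 <= W * ((1 + 2 * C) * e) by rewrite !mulr_ge0.
have Z0 : 0 <= `|s ord_max| by [].
set X := K * e in H X0 *; set Y := W * _ in H1 H2 Y0 *.
have -> : (K + (`|s ord_max| * (K + W * (1 + 2 * C)) + W * (1 + 2 * C))) * e =
  X + (`|s ord_max| * (X + Y) + Y) by rewrite /X /Y; ring.
split; first by apply: le_trans H _; rewrite lerDl addr_ge0// mulr_ge0// addr_ge0.
rewrite /=; move: H H1 H2.
set a := fine _; set b := fine _; set a' := fine _; set b' := fine _.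
set w := weighted_entropy _ _ _; set w' := weighted_entropy _ _ _ => H H1 H2.
have -> : s ord_max * (a - a') + w - (s ord_max * (b - b') + w') =
  s ord_max * ((a - b) - (a' - b')) + (w - w') by ring.
rewrite (le_trans (ler_normD _ _))// -[leLHS]add0r !lerD//.
rewrite normrM ler_wpM2l//.
by rewrite (le_trans (ler_normB _ _))// lerD.
Qed.

End gibbs_lipschitz.

(** * Duality *)

Section tangent.
Context (R : realType) (Phi : R -> R) (a b : R).
Hypothesis dPhi : forall x, derivable Phi x 1.
Hypothesis ddPhi : forall x, derivable (derive1 Phi) x 1.
Hypothesis Phi2 : forall x, a <= x <= b -> derive1 (derive1 Phi) x < 0.
Local Notation Phi' := (derive1 Phi).

Lemma derive1_decreasing x y : a <= x -> x < y -> y <= b -> Phi' y < Phi' x.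
Proof.
move=> ax xy yb; apply: (@ltr0_derive1_decr _ Phi' a b _ _ _ _ _ ax xy yb).
- by move=> z _; exact: ddPhi.
- move=> z; rewrite in_itv/= => /andP[az zb]; apply: Phi2.
  by rewrite (ltW az) (ltW zb).
- by apply: derivable_within_continuous => z _; exact: ddPhi.
Qed.

(** By the mean value theorem the chord has slope [Phi' c] with [c] between [x] and [y], and [Phi']
    decreases on [[a, b]]. *)
Lemma le_tangent x y : a <= x <= b -> a <= y <= b ->
  Phi y <= Phi x + Phi' x * (y - x).
Proof.
have mvt u v : u < v -> exists2 c, u < c < v & Phi v - Phi u = Phi' c * (v - u).
  move=> uv.
  have H1 z : z \in `]u, v[ -> is_derive z 1 Phi (Phi' z).
    by move=> _; rewrite derive1E; apply: derivableP; exact: dPhi.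
  have H2 : {within `[u, v], continuous Phi}.
    by apply: derivable_within_continuous => z _; exact: dPhi.
  by have [c] := MVT uv H1 H2; rewrite in_itv => ? ?; exists c.
move=> /andP[ax xb] /andP[ay yb].
have [xy|yx|->] := ltgtP x y; last by rewrite subrr mulr0 addr0.
- have [c /andP[xc cy] E] := mvt _ _ xy.
  have := derive1_decreasing ax xc (le_trans (ltW cy) yb) => d.
  have : Phi' c * (y - x) <= Phi' x * (y - x) by rewrite ler_wpM2r ?subr_ge0 ?ltW.
  by rewrite -E; lra.
- have [c /andP[yc cx] E] := mvt _ _ yx.
  have := derive1_decreasing (le_trans ay (ltW yc)) cx xb => d.
  have : Phi' x * (x - y) <= Phi' c * (x - y) by rewrite ler_wpM2r ?subr_ge0 ?ltW.
  by rewrite -E; lra.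
Qed.

(** The sign condition places [q'] strictly between [q] and [z]. Moving the point of tangency
    towards [z] strictly lowers the value of the tangent at [z]. *)
Lemma tangent_lt q q' z : a <= q <= b -> a <= q' <= b ->
  0 < (q' - q) * (z - q') ->
  Phi q' + Phi' q' * (z - q') < Phi q + Phi' q * (z - q).
Proof.
move=> qab q'ab H; have T := le_tangent qab q'ab.
suff : (Phi' q' - Phi' q) * (z - q') < 0 by lra.
case/andP: qab => aq qb; case/andP: q'ab => aq' q'b.
have [qq'|q'q|E] := ltgtP q q'; last by move: H; rewrite E subrr mul0r ltxx.
- have zq : 0 < z - q' by move: H; rewrite pmulr_rgt0// subr_gt0.
  by rewrite nmulr_rlt0// subr_lt0; exact: derive1_decreasing.
- have zq : z - q' < 0 by move: H; rewrite nmulr_rgt0// subr_lt0.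
  by rewrite pmulr_rlt0// subr_gt0; exact: derive1_decreasing.
Qed.

End tangent.

Lemma le_of_le_addM (R : realType) (x y M : R) : 0 <= M ->
  (forall e, 0 < e <= 1 -> x <= y + M * e) -> x <= y.
Proof.
move=> M0 H; rewrite leNgt; apply/negP => yx.
have D : 0 < M + (x - y) by rewrite ltr_wpDl// subr_gt0.
have D' : 0 < M + (x - y) + 1 by rewrite addr_gt0.
(* Chosen so that [e <= 1] and [M * e < x - y]. *)
pose e := (x - y) / (M + (x - y) + 1).
have e0 : 0 < e by rewrite divr_gt0// subr_gt0.
have e1 : e <= 1 by rewrite ler_pdivrMr// mul1r; lra.
have := H e; rewrite e0 e1 => /(_ isT).
have -> : M * e = (x - y) - e * (x - y + 1).
  by rewrite /e; field; rewrite gt_eqF.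
suff : 0 < e * (x - y + 1) by lra.
by rewrite mulr_gt0// addr_gt0// subr_gt0.
Qed.

(** For a fixed measure with mean [y] of [phi], comparing the functional at [q] and [q'] reduces to
    comparing two tangents of [Phi] at [y]. *)
Lemma drop_common_terms (R : realType) (A A' D D' q q' y z w s1 s2 : R) :
  A - q * D + (D * y + z) - w + s1 - s2 <=
  A' - q' * D' + (D' * y + z) - w + s1 - s2 ->
  A + D * (y - q) <= A' + D' * (y - q').
Proof. lra. Qed.

Lemma parisi_P0_norm (R : realType) k
    (mus : 'I_k -> probability (measurableTypeR R) R) (m : 'I_k -> R) (C : R)
    (g : 'rV[R]_k -> R) :
  (forall i, 0 < m i) -> bmeas C g -> `|parisi_P0 mus m g| <= C.
Proof.
elim: k mus m g => [|k IH] mus m g m0 gC /=; first exact: gC.2.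
by apply: IH => //; exact: bmeas_parisi_step.
Qed.

(** * The functional in the variable [t = 1/m] and weak duality *)

Section duality.
Context (R : realType) (n : nat) (Theta : R) (gamma : 'I_n -> R)
  (mus : 'I_n -> probability (measurableTypeR R) R)
  (mu : probability (borel_rV R n) R)
  (phi f : 'rV[R]_n -> R) (Phi : R -> R) (M : R).
Hypothesis Theta_gt0 : 0 < Theta.
Hypothesis gamma_gt0 : forall k, 0 < gamma k.
Hypothesis gamma_sum : \sum_(k < n) gamma k = 1.
Hypothesis mup : is_product_measure mus mu.
Hypothesis phiM : bmeas M phi.
Hypothesis fM : bmeas M f.
Hypothesis dPhi : forall x, derivable Phi x 1.
Hypothesis ddPhi : forall x, derivable (derive1 Phi) x 1.
Hypothesis Phi2 : forall x, inf (range phi) <= x <= sup (range phi) ->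
     derive1 (derive1 Phi) x < 0.

Local Notation Phi' := (derive1 Phi).
Let a := inf (range phi).
Let b := sup (range phi).
Let c (i : 'I_n) := gamma i * Theta * ln 2.
Let gq (q : R) (x : 'rV[R]_n) := Phi' q * phi x + f x.
(** The set [ordered_params] in the variable [t = 1/m]: it becomes closed and convex, and the
    penalty becomes linear. *)
Let feasible (t : 'I_n -> R) :=
  (forall i, 1 <= t i) /\ (forall i j : 'I_n, (i <= j)%N -> t j <= t i).
Let G q (t : 'I_n -> R) :=
  parisi_functional Theta gamma mus phi f Phi q (fun i => (t i)^-1).
(** [G] with [parisi_P0] replaced by its variational lower bound at [nu]. For fixed [q] and [nu] it
    is affine in [t]. *)
Let F q t (nu : probability (borel_rV R n) R) := Phi q - q * Phi' q + \int[nu]_x gq q x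
  - weighted_entropy t nu mu + \sum_(i < n) c i * t i - \sum_(i < n) c i.

Let ln2_gt0 : 0 < ln 2 :> R. Proof. by rewrite ln_gt0// ltr1n. Qed.

Let c_gt0 i : 0 < c i. Proof. by rewrite !mulr_gt0. Qed.

Let c_sum : \sum_(i < n) c i = Theta * ln 2.
Proof.
transitivity ((\sum_(k < n) gamma k) * (Theta * ln 2)).
  by rewrite mulr_suml; apply: eq_bigr => i _; rewrite /c mulrA.
by rewrite gamma_sum mul1r.
Qed.

Let GE q t : G q t = Phi q - q * Phi' q +
  parisi_P0 mus (fun i => (t i)^-1) (gq q) + \sum_(i < n) c i * t i
  - \sum_(i < n) c i.
Proof.
rewrite /G /parisi_functional c_sum; congr (_ + _ - _).
by apply: eq_bigr => i _; rewrite invrK.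
Qed.

Let gqM q : bmeas (`|Phi' q| * M + `|1| * M) (gq q).
Proof.
have := bmeas_lin (Phi' q) 1 phiM fM.
by rewrite /gq; under eq_fun do rewrite mul1r.
Qed.

Let M_ge0 : 0 <= M. Proof. exact: bmeas_ge0 phiM. Qed.

Let lb_phi x : a <= phi x.
Proof.
apply: ge_inf; last by exists x.
by exists (- M) => _ [y _ <-]; have := phiM.2 y; rewrite ler_norml => /andP[].
Qed.

Let ub_phi x : phi x <= b.
Proof.
apply: ub_le_sup; last by exists x.
by exists M => _ [y _ <-]; have := phiM.2 y; rewrite ler_norml => /andP[].
Qed.

Let ab : a <= b. Proof. exact: le_trans (lb_phi 0) (ub_phi 0). Qed.

Let int_phi (nu : probability (borel_rV R n) R) : a <= \int[nu]_x phi x <= b.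
Proof.
have i := bmeas_integrable nu phiM.
by rewrite (Rintegral_ge_cst i lb_phi) (Rintegral_le_cst i ub_phi).
Qed.

Let int_gq (nu : probability (borel_rV R n) R) q :
  \int[nu]_x gq q x = Phi' q * \int[nu]_x phi x + \int[nu]_x f x.
Proof.
rewrite RintegralD//.
- by rewrite RintegralZl//; exact: (bmeas_integrable nu phiM).
- exact: (bmeas_integrable nu (bmeas_scale _ phiM)).
- exact: (bmeas_integrable nu fM).
Qed.

Let F_le_G q t nu : (forall i, 0 < t i) -> finite_entropies nu mu ->
  F q t nu <= G q t.
Proof.
move=> t0 fin; rewrite GE /F !lerD2r -addrA lerD2l.
exact: (parisi_P0_ge mup t0 (gqM q) fin).
Qed.

Let G_gibbs q t : (forall i, 1 <= t i) -> exists nu,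
  [/\ finite_entropies nu mu, G q t = F q t nu &
      has_density nu mu (fun x => expR (gibbs_log_density mus t (gq q) x))].
Proof.
move=> t1; have [B BP] := bmeas_gibbs_log_density n (`|Phi' q| * M + `|1| * M).
have LB := BP mus t _ t1 (gqM q).
have [nu nuD] : exists nu : probability (borel_rV R n) R,
    has_density nu mu (fun x => expR (gibbs_log_density mus t (gq q) x)).
  apply: density_exists.
  - exact: (measurableT_comp (@measurable_expR R) LB.1).
  - by move=> x; exact: expR_ge0.
  - exact: (integral_gibbs_density mup t1 (gqM q)).
have [fin E] := parisi_P0_gibbs mup t1 (gqM q) nuD.
by exists nu; split => //; rewrite GE /F -E addrA.
Qed.

(** Sum of three inequalities: [F <= G], the tangent inequality for [Phi] at the mean of [phi], and
    summation by parts with [s = 1], which trades the weighted entropy for the plain one. *)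
Lemma weak_duality nu q t : a <= q <= b -> feasible t ->
  entropy_constraint Theta gamma mu nu ->
  ((bold_Phi phi f Phi nu)%:E - relative_entropy nu mu <= (G q t)%:E)%E.
Proof.
move=> qab [t1 tdec] nuK.
have fin : finite_entropies nu mu.
  apply/finite_entropies_marginal => k kn k1.
  by apply: le_lt_trans (nuK k kn k1) _; rewrite ltry.
have Hfin k (kn : (k <= n)%N) : (1 <= k)%N ->
   fine (relative_entropy (marginal kn nu) (marginal kn mu)) <=
    \sum_(j < n | (j < k)%N) c j.
  move=> k1; have := nuK k kn k1; have := (finite_entropies_marginal nu mu).1 fin k kn k1.
  case: (relative_entropy _ _) => //= [r _|_ _].
    rewrite lee_fin => /le_trans; apply; rewrite mulr_sumr le_eqVlt; apply/orP; left.
    by apply/eqP/eq_bigr => j _; rewrite /c; ring.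
  (* The value [-oo], which [fine] sends to 0. *)
  by apply: sumr_ge0 => j _; exact: ltW.
have := weighted_entropy_abel Hfin t1 tdec.
rewrite !mul1r => W.
have := F_le_G q (fun i => lt_le_trans ltr01 (t1 i)) fin.
rewrite /F int_gq; move: W; have := entropy_fin_num (finite_entropies_lty fin).
have := le_tangent dPhi ddPhi Phi2 qab (int_phi nu).
rewrite /bold_Phi; case: (relative_entropy nu mu) => [h| |] //=.
move=> T _ W GF; rewrite -EFinD lee_fin; move: T W GF.
move: (weighted_entropy _ _ _) (\sum_(i < n) c i * t i) (\sum_(i < n) c i).
move: (G q t) (\int[nu]_x phi x) (\int[nu]_x f x) => g y z w s1 s2.
lra.
Qed.

(** * Optimality conditions at a minimiser *)

Let minimal q t := forall q' t', a <= q' <= b -> feasible t' -> G q t <= G q' t'.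
Let is_gibbs (nu : probability (borel_rV R n) R) q t :=
  has_density nu mu (fun x => expR (gibbs_log_density mus t (gq q) x)).

(** With [nu'] the Gibbs measure at [t + e d], one has [F q t nu' <= G q t <= G q (t + e d) = F q (t
    + e d) nu']. As [F] is affine in [t], dividing by [e] gives the claim for [nu']; the Lipschitz
    bound carries it to [nu] as [e] tends to 0. *)
Let perturb_t q t nu (d : 'I_n -> R) : a <= q <= b -> feasible t ->
  minimal q t -> is_gibbs nu q t ->
  (forall e, 0 < e <= 1 -> feasible (fun i => t i + e * d i)) ->
  weighted_entropy d nu mu <= \sum_(i < n) c i * d i.
Proof.
move=> qab [t1 _] qtmin nuG dfeas.
have [K K0 KP] := weighted_entropy_lipschitz (`|Phi' q| * M + `|1| * M) d.
pose D := \sum_(i < n) `|d i|.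
have D0 : 0 <= D by exact: sumr_ge0.
apply: (@le_of_le_addM _ _ _ (K * D)); first by rewrite mulr_ge0.
move=> e /[dup] e01 /andP[e0 _]; have te := dfeas e e01.
have [nu' [fin' E nuG']] := G_gibbs q te.1.
have FG := F_le_G q (fun i => lt_le_trans ltr01 (t1 i)) fin'.
have := le_trans FG (qtmin q _ qab te); rewrite E /F weighted_entropyD.
have -> : \sum_(i < n) c i * (t i + e * d i) =
    \sum_(i < n) c i * t i + e * \sum_(i < n) c i * d i.
  by rewrite mulr_sumr -big_split; apply: eq_bigr => i _; rewrite mulrDr mulrCA.
move=> H; have {}H : e * weighted_entropy d nu' mu <= e * \sum_(i < n) c i * d i.
  by move: H; lra.
rewrite ler_pM2l// in H.
have tt i : `|t i - (t i + e * d i)| <= e * D.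
  rewrite opprD addrA subrr add0r normrN normrM gtr0_norm// ler_pM2l//.
  by rewrite /D (bigD1 i)//= lerDl sumr_ge0.
have gg x : `|gq q x - gq q x| <= e * D by rewrite subrr normr0 mulr_ge0// ltW.
have [_] := KP _ _ _ _ _ _ _ _ _ mup t1 te.1 (gqM q) (gqM q) nuG nuG' tt gg.
rewrite ler_distl => /andP[_ H']; apply: le_trans H' _.
by rewrite -mulrA [D * e]mulrC lerD2r.
Qed.

Let perturb_q q q' t (nu' : probability (borel_rV R n) R) :
  a <= q' <= b -> feasible t -> minimal q t ->
  finite_entropies nu' mu -> G q' t = F q' t nu' ->
  Phi q + Phi' q * (\int[nu']_x phi x - q) <=
  Phi q' + Phi' q' * (\int[nu']_x phi x - q').
Proof.
move=> qab' tf qtmin fin' E'.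
have FG := F_le_G q (fun i => lt_le_trans ltr01 (tf.1 i)) fin'.
have := le_trans FG (qtmin q' t qab' tf); rewrite E' /F !int_gq.
exact: drop_common_terms.
Qed.

(** If the mean [y] differed from [q], a small move of [q] towards [y] would yield a Gibbs mean [y']
    close to [y], with [q'] strictly between [q] and [y']. Then [tangent_lt] contradicts
    [perturb_q]. *)
Let opt_q q t nu : a <= q <= b -> feasible t -> minimal q t ->
  is_gibbs nu q t -> \int[nu]_x phi x = q.
Proof.
move=> qab tf qtmin nuG; apply/eqP/negPn/negP => yq.
set y := \int[nu]_x phi x in yq *.
have yab : a <= y <= b by exact: int_phi.
pose d := y - q; have d0 : 0 < `|d| by rewrite normr_gt0 subr_eq0.
(* A common bound for all [gq q'] with [Phi' q'] within 1 of [Phi' q]. *)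
pose C := (`|Phi' q| + 1) * M + `|1| * M.
have gC q' : `|Phi' q' - Phi' q| <= 1 -> bmeas C (gq q').
  move=> H; apply: bmeas_le (gqM q'); rewrite lerD2r ler_wpM2r//.
  by rewrite -lerBlDl (le_trans _ H)// lerB_dist.
have [K K0 KP] := gibbs_lipschitz n C.
have [B BP] := bmeas_gibbs_log_density n C.
pose K1 := M * (expR B * (K * M)).
have K10 : 0 <= K1 by rewrite !mulr_ge0 ?expR_ge0.
(* [K1] is the Lipschitz constant of the mean of [phi] in terms of [Phi' q]; the second term of the
   minimum makes the mean move by less than [|d| / 2]. *)
pose eta := Num.min 1 (`|d| / (2 * (K1 + 1))).
have eta0 : 0 < eta by rewrite lt_min ltr01/= divr_gt0// mulr_gt0// ltr_wpDl.
have : {for q, continuous Phi'}.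
  by apply: differentiable_continuous; apply/derivable1_diffP; exact: ddPhi.
move=> /cvgrPdist_lt /(_ _ eta0) /nbhs_ballP[r /= r0 rP].
(* The second bound keeps [q'] in the ball of radius [r] where [Phi'] varies by less than [eta]; the
   first leaves [1 - s > 1/2], so that [q'] does not pass [y']. *)
pose s := Num.min (4^-1) (r / (2 * `|d|)).
have s0 : 0 < s by rewrite lt_min invr_gt0 ltr0n/= divr_gt0// mulr_gt0.
have s4 : s <= 4^-1 by rewrite /s ge_min lexx.
have s1 : s <= 1 by rewrite (le_trans s4)// invf_le1 ?ler1n// ltr0n.
have sd : s * `|d| <= r / 2.
  have : s <= r / (2 * `|d|) by rewrite /s ge_min lexx orbT.
  by rewrite invfM mulrA ler_pdivlMr.
pose q' := q + s * d.
have qab' : a <= q' <= b.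
  have -> : q' = (1 - s) * q + s * y by rewrite /q' /d; ring.
  have s1' : 0 <= 1 - s by rewrite subr_ge0.
  move: qab yab => /andP[? ?] /andP[? ?]; apply/andP; split.
    by rewrite -[leLHS](_ : (1 - s) * a + s * a = a) ?lerD ?ler_wpM2l ?(ltW s0)//; ring.
  by rewrite -[leRHS](_ : (1 - s) * b + s * b = b) ?lerD ?ler_wpM2l ?(ltW s0)//; ring.
have eq : `|Phi' q - Phi' q'| < eta.
  apply: rP; rewrite /ball/= /q' opprD addrA subrr add0r normrN normrM gtr0_norm//.
  by rewrite (le_lt_trans sd)// ltr_pdivrMr// ltr_pMr// ltr1n.
have eq1 : `|Phi' q' - Phi' q| <= 1.
  by rewrite distrC (le_trans (ltW eq))// ge_min lexx.
have gCq : bmeas C (gq q) by apply: gC; rewrite subrr normr0.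
have gCq' := gC q' eq1.
have [nu' [fin' E' nuG']] := G_gibbs q' tf.1.
have tt i : `|t i - t i| <= `|Phi' q - Phi' q'| * M by rewrite subrr normr0 mulr_ge0.
have gg x : `|gq q x - gq q' x| <= `|Phi' q - Phi' q'| * M.
  rewrite /gq opprD addrACA subrr addr0 -mulrBl normrM ler_wpM2l//; exact: phiM.2.
have [_ LL] := KP mus t t _ _ _ tf.1 tf.1 gCq gCq' tt gg.
have := Rintegral_density_dist nuG nuG' (BP _ _ _ tf.1 gCq) (BP _ _ _ tf.1 gCq') LL phiM.
have -> : M * (expR B * (K * (`|Phi' q - Phi' q'| * M))) = K1 * `|Phi' q - Phi' q'|.
  by rewrite /K1; ring.
rewrite -/y; set y' := \int[nu']_x phi x => yy'.
have yd : `|y - y'| < `|d| / 2.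
  apply: (le_lt_trans yy'); apply: (@le_lt_trans _ _ (K1 * (`|d| / (2 * (K1 + 1))))).
    by rewrite ler_wpM2l// (le_trans (ltW eq))// ge_min lexx orbT.
  have K11 : 0 < K1 + 1 by rewrite ltr_wpDl.
  have -> : K1 * (`|d| / (2 * (K1 + 1))) = `|d| / 2 * (K1 / (K1 + 1)).
    by field; rewrite gt_eqF.
  by rewrite gtr_pMr ?divr_gt0// ltr_pdivrMr// mul1r ltrDl.
have := perturb_q qab' tf qtmin fin' E'; rewrite -/y' leNgt => /negP; apply.
apply: (tangent_lt dPhi ddPhi Phi2 qab qab').
have -> : (q' - q) * (y' - q') = s * (d ^+ 2 * (1 - s) - d * (y - y')).
  by rewrite /q' /d; ring.
rewrite mulr_gt0// subr_gt0 (le_lt_trans (ler_norm _))// normrM.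
apply: (@lt_le_trans _ _ (`|d| * (`|d| / 2))); first by rewrite ltr_pM2l.
rewrite mulrA -expr2 real_normK ?num_real// ler_wpM2l ?sqr_ge0//.
by move: s4; lra.
Qed.

Let minimal_attained q t : a <= q <= b -> feasible t -> minimal q t ->
  exists2 nu, entropy_constraint Theta gamma mu nu &
    ((G q t)%:E <= (bold_Phi phi f Phi nu)%:E - relative_entropy nu mu)%E.
Proof.
move=> qab tf qtmin; have [t1 tdec] := tf.
have [nu [fin E nuG]] := G_gibbs q t1.
have yq := opt_q qab tf qtmin nuG.
have Hoo := finite_entropies_lty fin.
exists nu => [k kn k1|].
  have := (finite_entropies_marginal nu mu).1 fin k kn k1.
  (* Raising the first [k] entries keeps [t] nonincreasing, and in this direction the optimality
     condition is the constraint on [H_k]. *)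
  have := perturb_t (d := fun i => (i < k)%:R) qab tf qtmin nuG.
  rewrite (weighted_entropy_indic kn) => H.
  have {}H : fine (relative_entropy (marginal kn nu) (marginal kn mu)) <=
      \sum_(i < n) c i * (i < k)%:R.
    apply: H => e /andP[e0 _]; split=> [i|i j ij].
      by rewrite (le_trans (t1 i))// lerDl mulr_ge0// ltW.
    rewrite lerD ?tdec// ler_pM2l// ler_nat.
    by case: (ltnP j k) => // jk; rewrite (leq_ltn_trans ij jk).
  move: H; case: (relative_entropy _ _) => [h| |] //=; last by rewrite leNye.
  move=> H _; rewrite lee_fin; apply: (le_trans H).
  rewrite mulr_sumr [leRHS]big_mkcond/=; apply: ler_sum => i _.
  by case: ifP => _; rewrite ?mulr1 ?mulr0// /c; lra.
(* The direction from [t] towards the constant 1 reverses the inequality obtained by summation by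
   parts: complementary slackness. *)
have W : weighted_entropy (fun i => 1 + (- 1) * t i) nu mu <=
    \sum_(i < n) c i * (1 + (- 1) * t i).
  apply: (perturb_t qab tf qtmin nuG) => e /andP[e0 e1]; split=> [i|i j ij].
    have := t1 i; move: e0 e1; nra.
  have := tdec i j ij; move: e0 e1; nra.
move: W; rewrite weighted_entropyD.
have -> : weighted_entropy (fun=> 1) nu mu = fine (relative_entropy nu mu).
  rewrite -[RHS](_ : fine (relative_entropy (marginal (leqnn n) nu) (marginal (leqnn n) mu)) = _).
    by rewrite -weighted_entropy_indic; congr (weighted_entropy _ _ _);
      apply/funext => i; rewrite ltn_ord.
  by rewrite !marginal_id.
have -> : \sum_(i < n) c i * (1 + (- 1) * t i) = \sum_(i < n) c i - \sum_(i < n) c i * t i.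
  by rewrite -sumrB; apply: eq_bigr => i _; ring.
rewrite E /F int_gq /bold_Phi yq.
move: (entropy_fin_num Hoo); case: (relative_entropy nu mu) => [h| |] //=.
move=> _; rewrite -EFinD lee_fin.
move: (weighted_entropy _ _ _) (\sum_(i < n) c i * t i) (\sum_(i < n) c i) (\int[nu]_x f x).
by move=> w s1 s2 z; lra.
Qed.

(** * Existence of a minimiser *)

Let C0 := (`|Phi' a| + `|Phi' b|) * M + `|1| * M.

Let Phi'_norm q : a <= q <= b -> `|Phi' q| <= `|Phi' a| + `|Phi' b|.
Proof.
move=> /andP[aq qb].
have u : Phi' q <= Phi' a.
  move: aq; rewrite le_eqVlt => /predU1P[<-//|aq].
  by rewrite ltW// (derive1_decreasing ddPhi Phi2).
have l : Phi' b <= Phi' q.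
  move: qb; rewrite le_eqVlt => /predU1P[<-//|qb].
  by rewrite ltW// (derive1_decreasing ddPhi Phi2).
rewrite ler_norml; apply/andP; split.
  rewrite lerNl; apply: (@le_trans _ _ `|Phi' b|); last by rewrite lerDr.
  by rewrite (@le_trans _ _ (- Phi' b)) ?lerN2// -normrN ler_norm.
apply: (le_trans u); apply: (le_trans (ler_norm _)).
by rewrite lerDl.
Qed.

Let gq_bmeas q : a <= q <= b -> bmeas C0 (gq q).
Proof.
by move=> qab; apply: bmeas_le (gqM q); rewrite lerD2r ler_wpM2r// Phi'_norm.
Qed.

(** Coercivity in each [t_i]. The tangent inequality at [q], evaluated at [a], bounds
    [Phi q - q * Phi' q] below by [Phi a - a * Phi' q], the recursion is at least [- C0], and the
    other penalty terms are nonnegative. *)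
Let G_lower : exists L : R, forall q t i, a <= q <= b -> feasible t ->
  L + c i * t i <= G q t.
Proof.
exists (Phi a - `|a| * (`|Phi' a| + `|Phi' b|) - C0 - \sum_(i < n) c i).
move=> q t i qab [t1 _]; rewrite GE.
have t0 j : 0 < (t j)^-1 by rewrite invr_gt0 (lt_le_trans ltr01).
have aab : a <= a <= b by rewrite lexx ab.
have := le_tangent dPhi ddPhi Phi2 qab aab.
have : - (`|a| * (`|Phi' a| + `|Phi' b|)) <= - a * Phi' q.
  rewrite lerNl -mulNr opprK; apply: (le_trans (ler_norm _)).
  by rewrite normrM ler_wpM2l// Phi'_norm.
have := parisi_P0_norm mus t0 (gq_bmeas qab); rewrite ler_norml => /andP[+ _].
have : c i * t i <= \sum_(j < n) c j * t j.
  rewrite (bigD1 i)//= lerDl sumr_ge0// => j _.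
  by rewrite mulr_ge0// ltW// (lt_le_trans ltr01).
move: (parisi_P0 _ _ _) (\sum_(j < n) c j * t j) (\sum_(j < n) c j) (c i * t i).
move: (`|a| * _) C0 (Phi a) (Phi q) (Phi' q) => x1 x2 x3 x4 x5 x6 x7 x8 x9.
by lra.
Qed.

(** The variations of [Phi'] and of [q |-> Phi q - q * Phi' q] are hypotheses in place of
    [|q - q'|], so that continuity of these two functions suffices later. *)
Let G_dist : exists2 K : R, 0 <= K &
  forall q q' t t' e, a <= q <= b -> a <= q' <= b ->
    feasible t -> feasible t' ->
    `|Phi q - q * Phi' q - (Phi q' - q' * Phi' q')| <= e ->
    `|Phi' q - Phi' q'| <= e -> (forall i, `|t i - t' i| <= e) ->
    `|G q t - G q' t'| <= K * e.
Proof.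
have [K K0 KP] := gibbs_lipschitz n C0.
exists (1 + K * (M + 1) + \sum_(i < n) c i).
  by rewrite !addr_ge0 ?mulr_ge0 ?addr_ge0 ?sumr_ge0// => i _; rewrite ltW.
move=> q q' t t' e qab qab' [t1 _] [t1' _] psi dphi tt.
have e0 : 0 <= e by apply: le_trans dphi.
(* [gibbs_lipschitz] wants one bound for both perturbations: [e] for [t] and [M * e] for [gq]. *)
have tt1 i : `|t i - t' i| <= (M + 1) * e.
  by rewrite (le_trans (tt i))// ler_peMl// lerDr.
have gg x : `|gq q x - gq q' x| <= (M + 1) * e.
  rewrite /gq opprD addrACA subrr addr0 -mulrBl normrM mulrC mulrDl mul1r.
  apply: (@le_trans _ _ (M * e)); last by rewrite lerDl.
  by rewrite ler_pM// phiM.2.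
have [P _] := KP mus t t' _ _ _ t1 t1' (gq_bmeas qab) (gq_bmeas qab') tt1 gg.
have S : `|\sum_(i < n) c i * t i - \sum_(i < n) c i * t' i| <=
    (\sum_(i < n) c i) * e.
  rewrite -sumrB mulr_suml (le_trans (ler_norm_sum _ _ _))// ler_sum// => i _.
  by rewrite -mulrBr normrM gtr0_norm// ler_wpM2l// ltW.
rewrite !GE; move: psi P S.
move: (Phi q - _) (Phi q' - _) (parisi_P0 _ _ _) (parisi_P0 _ _ _).
move=> p p' P' P psi HP S.
set s := \sum_(i < n) c i * t i in S *; set s' := \sum_(i < n) c i * t' i in S *.
have -> : p + P + s - \sum_(i < n) c i - (p' + P' + s' - \sum_(i < n) c i) =
  (p - p') + (P - P') + (s - s') by ring.
rewrite !mulrDl mul1r (le_trans (ler_normD _ _))// lerD//.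
by rewrite (le_trans (ler_normD _ _))// lerD// -mulrA.
Qed.

Let feasible_cst1 : feasible (fun=> 1). Proof. by split. Qed.

(** A continuous function attains its minimum on the compact set of feasible [t] with entries at
    most [T]; beyond [T], coercivity makes [G] at least the value [V] at a point of this set. *)
Let exists_minimal : exists q t, [/\ a <= q <= b, feasible t & minimal q t].
Proof.
have [L LP] := G_lower; have [K K0 KP] := G_dist.
have aab : a <= a <= b by rewrite lexx ab.
pose V := G a (fun=> 1).
(* Large enough that [L + c i * T >= V] for every [i]. *)
pose T := 1 + \sum_(i < n) `|V - L| / c i.
have T1 : 1 <= T by rewrite lerDl sumr_ge0// => i _; rewrite divr_ge0// ltW.
pose Box := [set v : 'rV[R]_n | forall i, `[1, T]%classic (v ord0 i)].
pose Mono := [set v : 'rV[R]_n | feasible (v ord0)].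
pose A := `[a, b]%classic `*` (Box `&` Mono) : set (R * 'rV[R]_n).
have Ap p : A p -> a <= p.1 <= b /\ feasible (p.2 ord0).
  by move=> [/= qab [_ tf]]; rewrite in_itv/= in qab.
have closed_Mono : closed Mono.
  (* Indices in the wrong order get the constant 0, for which the second condition is vacuous. *)
  have -> : Mono = \bigcap_(ij in [set: 'I_n * 'I_n])
      ((fun v : 'rV[R]_n => v ord0 ij.1) @^-1` [set x | 1 <= x] `&`
       (fun v : 'rV[R]_n => if (ij.1 <= ij.2)%N then v ord0 ij.1 - v ord0 ij.2 else 0)
          @^-1` [set x | 0 <= x]).
    apply/seteqP; split => [v [v1 vdec] [i j] _ /=|v H].
      by split => //; case: ifP => // ij; rewrite subr_ge0 vdec.
    split => [i|i j ij]; first by have [] := H (i, i) I.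
    by have [_] := H (i, j) I; rewrite /= ij subr_ge0.
  apply: closed_bigI => -[i j] _ /=; apply: closedI.
    by apply: preimage_closed (@closed_ge R 1) => v _; exact: coord_continuous.
  case: (i <= j)%N; apply: preimage_closed (@closed_ge R 0) => v _.
    by apply: continuousB; exact: coord_continuous.
  exact: cst_continuous.
have cA : compact A.
  apply: compact_setX; first exact: segment_compact.
  apply: compact_closedI => //.
  by apply: (@rV_compact _ n (fun=> `[1, T]%classic)) => i; exact: segment_compact.
have const1 : (const_mx 1 : 'rV[R]_n) ord0 = (fun=> 1).
  by apply/funext => i; rewrite mxE.
have A0 : A !=set0.
  exists (a, const_mx 1); split; first by rewrite /= in_itv.
  split; first by move=> i /=; rewrite mxE in_itv/= lexx.
  by rewrite /Mono/= const1.
pose g (p : R * 'rV[R]_n) := G p.1 (p.2 ord0).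
have cg : {within A, continuous g}.
  apply/subspace_continuousP => p pA; apply/cvgrPdist_lt => eps eps0.
  have [qab tf] := Ap _ pA.
  pose r := eps / (K + 1).
  have K1 : 0 < K + 1 by rewrite ltr_wpDl.
  have r0 : 0 < r by rewrite divr_gt0.
  have Kr : K * r < eps.
    by rewrite /r mulrCA gtr_pMr// ltr_pdivrMr// mul1r ltrDl.
  have cPhi : {for p.1, continuous Phi}.
    by apply: differentiable_continuous; apply/derivable1_diffP; exact: dPhi.
  have cPhi' : {for p.1, continuous Phi'}.
    by apply: differentiable_continuous; apply/derivable1_diffP; exact: ddPhi.
  have cpsi : {for p.1, continuous (fun q => Phi q - q * Phi' q)}.
    apply: continuousB; first exact: cPhi.
    by apply: continuousM; [exact: cvg_id|exact: cPhi'].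
  have N1 : \forall p' \near within A (nbhs p), `|Phi p.1 - p.1 * Phi' p.1 -
      (Phi p'.1 - p'.1 * Phi' p'.1)| < r.
    apply: cvg_within; move/cvgrPdist_lt : cpsi => /(_ _ r0) H.
    by apply: (@cvg_fst _ _ (nbhs p.1) (nbhs p.2) _ _ H).
  have N2 : \forall p' \near within A (nbhs p), `|Phi' p.1 - Phi' p'.1| < r.
    apply: cvg_within; move/cvgrPdist_lt : cPhi' => /(_ _ r0) H.
    by apply: (@cvg_fst _ _ (nbhs p.1) (nbhs p.2) _ _ H).
  have N3 : \forall p' \near within A (nbhs p), ball p.2 r p'.2.
    apply: cvg_within; have H := nbhsx_ballx p.2 _ r0.
    by apply: (@cvg_snd _ _ (nbhs p.1) (nbhs p.2) _ _ H).
  near=> p'.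
  have /Ap[qab' tf'] : A p' by near: p'; exact: withinT.
  apply: le_lt_trans Kr; apply: KP => //.
  - by apply: ltW; near: p'.
  - by apply: ltW; near: p'.
  - move=> i; have : ball p.2 r p'.2 by near: p'.
    by move=> [_ H]; exact: ltW (H ord0 i).
have [p pA pmin] := compact_EVT_min A0 cA cg.
rewrite inE in pA; have [qab tf] := Ap _ pA.
exists p.1, (p.2 ord0); split => // q' t' qab' tf'.
have [/forallP tT|] := boolP [forall i, t' i <= T].
  have E : (\row_i t' i) ord0 = t' by apply/funext => i; rewrite mxE.
  have := pmin (q', \row_i t' i); rewrite /g /= E; apply.
  rewrite inE; split => /=; first by rewrite in_itv.
  split; last by rewrite /Mono /= E.
  by move=> i; rewrite /= mxE in_itv/= tf'.1 tT.
rewrite negb_forall => /existsP[i]; rewrite -ltNge => Ti.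
have pV : G p.1 (p.2 ord0) <= V.
  have := pmin (a, const_mx 1); rewrite /g /= const1; apply.
  rewrite inE; split; first by rewrite /= in_itv.
  split; first by move=> j /=; rewrite mxE in_itv/= lexx.
  by rewrite /Mono /= const1.
apply: (le_trans pV); apply: le_trans (LP q' t' i qab' tf').
rewrite -lerBlDl; apply: (le_trans (ler_norm _)).
rewrite mulrC -ler_pdivrMr// (le_trans _ (ltW Ti))//.
by rewrite /T (bigD1 i)//= addrCA lerDl addr_ge0// sumr_ge0// => j _; rewrite divr_ge0// ltW.
Unshelve. all: by end_near.
Qed.

Lemma strong_duality : exists q t nu,
  [/\ a <= q <= b, feasible t, entropy_constraint Theta gamma mu nu &
    ((G q t)%:E <= (bold_Phi phi f Phi nu)%:E - relative_entropy nu mu)%E].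
Proof.
have [q [t [qab tf qtmin]]] := exists_minimal.
have [nu nuK H] := minimal_attained qab tf qtmin.
by exists q, t, nu.
Qed.

End duality.

(** * The variational formula *)

Theorem theorem2p2 (R : realType) (n : nat) (Theta : R) (gamma : 'I_n -> R)
  (mus : 'I_n -> probability (measurableTypeR R) R)
  (mu : probability (borel_rV R n) R)
  (phi f : 'rV[R]_n -> R) (Phi : R -> R)
  (Theta_gt0 : 0 < Theta)
  (gamma_gt0 : forall k, 0 < gamma k)
  (gamma_sum : \sum_(k < n) gamma k = 1)
  (mu_product : is_product_measure mus mu)
  (phi_bounded : bounded_fun phi) (phi_continuous : continuous phi)
  (f_bounded : bounded_fun f) (f_continuous : continuous f)
  (Phi_derivable : forall x, derivable Phi x 1)
  (Phi'_derivable : forall x, derivable (derive1 Phi) x 1)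
  (Phi''_lt0 : forall x, inf (range phi) <= x <= sup (range phi) ->
     derive1 (derive1 Phi) x < 0) :
  ereal_sup [set ((bold_Phi phi f Phi nu)%:E - relative_entropy nu mu)%E
            | nu in entropy_constraint Theta gamma mu] =
  ereal_inf [set (parisi_functional Theta gamma mus phi f Phi qm.1 qm.2)%:E
            | qm in `[inf (range phi), sup (range phi)] `*`
                    @ordered_params R n].
Proof.
have [M [phiM fM]] : exists M, bmeas M phi /\ bmeas M f.
  move: phi_bounded f_bounded => [M1 [_ H1]] [M2 [_ H2]].
  (* [bounded_fun] gives bounds by all numbers strictly above [M1] and [M2], hence the added 1. *)
  exists (Num.max M1 M2 + 1); split; split.
  - exact: continuous_measurable_rV.
  - by move=> x; apply: (H1 _ _ x) => //; rewrite ltr_pwDr// le_max lexx.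
  - exact: continuous_measurable_rV.
  - by move=> x; apply: (H2 _ _ x) => //; rewrite ltr_pwDr// le_max lexx orbT.
apply/eqP; rewrite eq_le; apply/andP; split.
- apply: ge_ereal_sup => _ [nu nuK <-]; apply: le_ereal_inf_tmp => _ [[q m] /= [qab [m01 mle]] <-].
  have -> : m = fun i => ((m i)^-1)^-1 by apply/funext => i; rewrite invrK.
  rewrite in_itv/= in qab.
  apply: (weak_duality (M := M)) => //.
  split => [i|i j ij].
    by have /andP[m0 m1] := m01 i; rewrite -invr1 lef_pV2 ?posrE.
  have /andP[mi0 _] := m01 i; have /andP[mj0 _] := m01 j.
  by rewrite lef_pV2 ?posrE// mle.
- have [q [t [nu [qab [t1 tdec] nuK H]]]] := strong_duality Theta_gt0 gamma_gt0
    gamma_sum mu_product phiM fM Phi_derivable Phi'_derivable Phi''_lt0.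
  apply: (@le_trans _ _ ((bold_Phi phi f Phi nu)%:E - relative_entropy nu mu)%E); last first.
    by apply: ereal_sup_ubound; exists nu.
  apply: le_trans H; apply: ereal_inf_lbound.
  exists (q, fun i => (t i)^-1) => //; split => /=; first by rewrite in_itv.
  have t0 i : 0 < t i by apply: lt_le_trans (t1 i).
  split => [i|i j ij]; first by rewrite invr_gt0 t0/= invf_le1.
  by rewrite lef_pV2 ?posrE// tdec.
Qed.
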